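(* Let $X$ and $Y$ be one-sided shift spaces. If $\Phi\colon\mathcal O_X\to\mathcal O_Y$ is a $^*$-isomorphism satisfying $\Phi(C(X))=C(Y)$, then $\Phi(\mathcal D_X)=\mathcal D_Y$.
   Context: **Shift spaces.** $\mathbb N=\{0,1,2,\dots\}$. A one-sided shift space is a closed subset $X\subseteq\mathfrak A^{\mathbb N}$ ($\mathfrak A$ a finite discrete alphabet, product topology) with $\sigma(X)\subseteq X$ (equality not assumed), where $\sigma(x)_n=x_{n+1}$; put $\sigma_X=\sigma|_X$. Write $x_{[i,j)}=x_i\cdots x_{j-1}$, and let $P_l(x)$ be the set of words $\mu$ of length $l$ over $\mathfrak A$ with $\mu x\in X$. **Cover.** Let $\mathcal I=\{(k,l)\in\mathbb N\times\mathbb N: k\le l\}$ with $(k_1,l_1)\preceq(k_2,l_2)$ iff $k_1\le k_2$ and $l_1-k_1\le l_2-k_2$. For $(k,l)\in\mathcal I$ let $x\overset{k,l}{\sim}x'$ iff $x_{[0,k)}=x'_{[0,k)}$ and $\bigcup_{l'\le l}P_{l'}(\sigma_X^k(x))=\bigcup_{l'\le l}P_{l'}(\sigma_X^k(x'))$; let ${}_k[x]_l$ be the class of $x$ and ${}_kX_l$ the (finite, discrete) set of classes. If $(k_1,l_1)\preceq(k_2,l_2)$ then ${}_{k_2}[x]_{l_2}\mapsto{}_{k_1}[x]_{l_1}$ is well defined, and the cover $\widetilde X$ is the projective limit of the ${}_kX_l$ along these maps, a compact Hausdorff space. The map $\sigma_{\widetilde X}\colon\widetilde X\to\widetilde X$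 is defined by: the $(k,l)$-coordinate of $\sigma_{\widetilde X}(\tilde x)$ is ${}_k[\sigma_X(y)]_l$ for any representative $y$ of the $(k+1,l+1)$-coordinate of $\tilde x$ (for $k<l$ one may use the $(k+1,l)$-coordinate); it is a local homeomorphism. The factor map $\pi_X\colon\widetilde X\to X$ sends $\tilde x$ to the unique $x\in X$ such that $x_{[0,k)}=y_{[0,k)}$ for every $(k,l)\in\mathcal I$ and every representative $y$ of the $(k,l)$-coordinate of $\tilde x$; it is a continuous surjection and $\sigma_X\circ\pi_X=\pi_X\circ\sigma_{\widetilde X}$. **Groupoid.** $\mathcal G_X=\{(\tilde x,p,\tilde y)\in\widetilde X\times\mathbb Z\times\widetilde X:\exists i,j\in\mathbb N,\ p=i-j,\ \sigma_{\widetilde X}^i(\tilde x)=\sigma_{\widetilde X}^j(\tilde y)\}$ with product $(\tilde x,p,\tilde y)(\tilde y,q,\tilde z)=(\tilde x,p+q,\tilde z)$ and inverse $(\tilde y,-p,\tilde x)$, and topology generated by the sets $\{(\tilde x,i-j,\tilde y):\tilde x\in U,\tilde y\in V,\sigma_{\widetilde X}^i(\tilde x)=\sigma_{\widetilde X}^j(\tilde y)\}$ with $U,V\subseteq\widetilde X$ open, $\sigma^i_{\widetilde X}|_U$, $\sigma^j_{\widetilde X}|_V$ injective and $\sigma_{\widetilde X}^i(U)=\sigma_{\widetilde X}^j(V)$. It is a second-countable locally compact Hausdorff étale amenable groupoid with unit space identified with $\widetilde X$. **$C^*$-algebras.** $\mathcal O_X=C^*(\mathcal G_X)$ (full = reduced),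 $\mathcal D_X=C(\widetilde X)\subseteq\mathcal O_X$ (functions on the unit space), and $C(X)$ is regarded as a subalgebra of $\mathcal D_X$ via $f\mapsto f\circ\pi_X$. *)

(* Defs.v *)
From HB Require Import structures.
From mathcomp Require Import all_boot all_order all_algebra.
From mathcomp Require Import complex zify ring lra.
From mathcomp Require Import all_classical all_reals all_analysis.

Set Implicit Arguments.
Unset Strict Implicit.
Unset Printing Implicit Defensive.

Import Order.TTheory GRing.Theory Num.Theory.
Import numFieldNormedType.Exports.
Local Open Scope classical_set_scope.
Local Open Scope ring_scope.
Local Open Scope complex_scope.

(** * One-sided shift spaces *)

Definition full_shift (A : finType) : Type :=
  prod_topology (fun _ : nat => discrete_topology A).
HB.instance Definition _ (A : finType) := Topological.on (full_shift A).

Definition sigma (A : finType) (x : full_shift A) : full_shift A :=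
  fun n => x n.+1.

Record shift_space (A : finType) := ShiftSpace {
  points : set (full_shift A);
  points_closed : closed points;
  points_sigma : forall x, points x -> points (sigma x)
}.

Definition prepend (A : finType) (mu : seq A) (x : full_shift A) :
  full_shift A := fun n => nth (x (n - size mu)%N) mu n.

(** * The cover *)

Definition cover_index : Type := {kl : nat * nat | (kl.1 <= kl.2)%N}.

Definition cover_le (i j : cover_index) : bool :=
  ((val i).1 <= (val j).1)%N &&
  ((val i).2 - (val i).1 <= (val j).2 - (val j).1)%N.

Definition cover_succ (i : cover_index) : cover_index :=
  exist (fun kl : nat * nat => (kl.1 <= kl.2)%N)
    ((val i).1.+1, (val i).2.+1) (valP i).

Section Cover.
Variables (A : finType) (X : shift_space A).

(** [past l x] is the set of words written P_l(x), and [pasts i x] is the union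
    of the P_l'(sigma^k(x)) over l' <= l, for i = (k, l). *)
Definition past (l : nat) (x : full_shift A) : set (seq A) :=
  [set mu | size mu = l /\ points X (prepend mu x)].

Definition pasts (i : cover_index) (x : full_shift A) : set (seq A) :=
  \bigcup_(l in [set l | (l <= (val i).2)%N])
    past l (iter (val i).1 (@sigma A) x).

(** [mkseq x k] is the prefix of length k of x. *)
Definition cover_equiv (i : cover_index) (x x' : full_shift A) : Prop :=
  mkseq x (val i).1 = mkseq x' (val i).1 /\ pasts i x = pasts i x'.

Definition eqclass (i : cover_index) (x : full_shift A) : set (full_shift A) :=
  [set x' | points X x' /\ cover_equiv i x x'].

(** A class is coded by its extension, so the sets of classes at all indices lie
    in the discrete space of all sets of sequences, and the projective limit is
    a subspace of the product.  The second clause of [cover_set] says that the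
    j-th class is sent to the i-th one whenever i precedes j. *)
Definition class_family : Type :=
  prod_topology (fun _ : cover_index => discrete_topology (set (full_shift A))).
HB.instance Definition _ := Topological.on class_family.

Definition cover_set : set class_family :=
  [set t | (forall i, exists2 x, points X x & t i = eqclass i x) /\
     (forall i j x, cover_le i j -> points X x ->
        t j = eqclass j x -> t i = eqclass i x)].

Definition cover : Type := set_type cover_set.
HB.instance Definition _ := Topological.on cover.

Definition coordinate (t : cover) (i : cover_index) : set (full_shift A) := \val t i.

Lemma eqclass_refl i x : points X x -> eqclass i x x.
Proof. by move=> Xx; split. Qed.

Lemma cover_equiv_eqclass i x x' : cover_equiv i x x' -> eqclass i x = eqclass i x'.
Proof.
move=> [h1 h2]; rewrite /eqclass /cover_equiv; apply/seteqP.
by split=> z /= [Xz [e1 e2]]; split=> //; split; rewrite ?h1 ?h2 // -?h1 -?h2.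
Qed.

Lemma coordinate_eqclass (t : cover) i y : coordinate t i y ->
  points X y /\ coordinate t i = eqclass i y.
Proof.
have /set_mem [+ _] := valP t; move=> /(_ i) [x Xx].
rewrite /coordinate => -> /= [Xy e]; split=> //; exact: cover_equiv_eqclass.
Qed.

Lemma coordinate_ex (t : cover) i : exists y, coordinate t i y.
Proof.
have /set_mem [+ _] := valP t; move=> /(_ i) [x Xx].
by rewrite /coordinate => ->; exists x; exact: eqclass_refl.
Qed.

Lemma coordinate_le (t : cover) i j : cover_le i j -> coordinate t j `<=` coordinate t i.
Proof.
move=> ij y /coordinate_eqclass[Xy e].
have /set_mem [_ h] := valP t.
by rewrite /coordinate (h i j y ij Xy e); exact: eqclass_refl.
Qed.

Lemma prepend_prefix k mu (x : full_shift A) :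
  prepend (mu ++ mkseq x k) (iter k (@sigma A) x) = prepend mu x.
Proof.
have it m : forall (z : full_shift A) n, iter m (@sigma A) z n = z (m + n)%N.
  elim: m => // m IH z n; rewrite iterSr IH /sigma.
  by rewrite addSn.
apply/funext => n; rewrite /prepend it size_cat size_mkseq nth_cat.
case: ltnP => [nmu|mun]; first exact: set_nth_default.
rewrite (nth_default _ mun).
have [nk|kn] := ltnP (n - size mu) k; first by rewrite nth_mkseq.
by rewrite nth_default ?size_mkseq // subnDA subnKC.
Qed.

Lemma iter_prefix m k (x x' : full_shift A) : (m <= k)%N ->
  mkseq x k = mkseq x' k ->
  mkseq (iter m (@sigma A) x) (k - m) = mkseq (iter m (@sigma A) x') (k - m).
Proof.
elim: m k x x' => [|m IH] [|k] x x' //.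
rewrite ltnS subSS !iterSr => mk e; apply: IH => //.
apply: (@eq_from_nth _ (x 0%N)); rewrite ?size_mkseq // => n ni.
rewrite !nth_mkseq //.
have := congr1 (fun s => nth (x 0%N) s n.+1) e.
by rewrite !nth_mkseq.
Qed.

Lemma mkseq_prefix m k (x x' : full_shift A) : (m <= k)%N ->
  mkseq x k = mkseq x' k -> mkseq x m = mkseq x' m.
Proof.
move=> mk e; apply: (@eq_from_nth _ (x 0%N)); rewrite ?size_mkseq // => n ni.
rewrite !nth_mkseq //.
have := congr1 (fun s => nth (x 0%N) s n) e.
by rewrite !nth_mkseq // (leq_trans ni).
Qed.

Lemma pastsP i (x : full_shift A) mu : pasts i x mu <->
  (size mu <= (val i).2)%N /\ points X (prepend mu (iter (val i).1 (@sigma A) x)).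
Proof.
split=> [[l /= li [smu Xmu]]|[smu Xmu]]; first by rewrite smu.
by exists (size mu).
Qed.

Lemma cover_equiv_le i j x x' : cover_le i j -> cover_equiv j x x' -> cover_equiv i x x'.
Proof.
move=> /andP[ij1 ij2] [e1 e2]; split; first exact: mkseq_prefix e1.
suff sub y y' : mkseq y (val j).1 = mkseq y' (val j).1 ->
    pasts j y = pasts j y' -> pasts i y `<=` pasts i y'.
  by apply/seteqP; split; apply: sub.
move=> {}e1 {}e2 mu /pastsP[smu Xmu]; apply/pastsP; split=> //.
set d := ((val j).1 - (val i).1)%N.
have jd z : iter (val j).1 (@sigma A) z =
    iter d (@sigma A) (iter (val i).1 (@sigma A) z) by rewrite -iterD subnK.
have := prepend_prefix d mu (iter (val i).1 (@sigma A) y).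
have := prepend_prefix d mu (iter (val i).1 (@sigma A) y').
rewrite -!jd (iter_prefix ij1 e1) => <- h.
have : pasts j y (mu ++ mkseq (iter (val i).1 (@sigma A) y') d).
  apply/pastsP; rewrite h; split=> //; rewrite size_cat size_mkseq /d.
  have := valP i; have := valP j; lia.
by rewrite e2 => /pastsP[].
Qed.

Lemma cover_equiv_sigma i x x' :
  cover_equiv (cover_succ i) x x' -> cover_equiv i (sigma x) (sigma x').
Proof.
move=> [e1 e2]; split.
  apply: (@eq_from_nth _ (x 0%N)); rewrite ?size_mkseq // => n ni.
  rewrite !nth_mkseq //.
  have := congr1 (fun s => nth (x 0%N) s n.+1) e1.
  by rewrite !nth_mkseq.
apply/seteqP; split=> mu /pastsP[smu]; rewrite -iterSr => Xmu; apply/pastsP;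
  rewrite -iterSr; split=> //.
  have : pasts (cover_succ i) x mu by apply/pastsP; split=> //; exact: leqW.
  by rewrite e2 => /pastsP[].
have : pasts (cover_succ i) x' mu by apply/pastsP; split=> //; exact: leqW.
by rewrite -e2 => /pastsP[].
Qed.

(** The union ranges over the representatives of the (k+1, l+1)-coordinate; all
    of them give the same class, by [cover_sigma_familyE]. *)
Definition cover_sigma_family (t : cover) : class_family :=
  fun i => \bigcup_(y in coordinate t (cover_succ i)) eqclass i (sigma y).

Lemma cover_sigma_familyE (t : cover) i y : coordinate t (cover_succ i) y ->
  cover_sigma_family t i = eqclass i (sigma y).
Proof.
move=> ty; apply/seteqP; split=> [z [y' ty']|z yz]; last by exists y.
rewrite (@cover_equiv_eqclass i (sigma y') (sigma y)) //.
apply: cover_equiv_sigma.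
by move: ty; have [_ ->] := coordinate_eqclass ty' => -[].
Qed.

Lemma cover_sigma_subproof (t : cover) : cover_set (cover_sigma_family t).
Proof.
split=> [i|i j x ij Xx].
  have [y ty] := coordinate_ex t (cover_succ i).
  exists (sigma y); last exact: cover_sigma_familyE.
  by apply: points_sigma; have [] := coordinate_eqclass ty.
have [y ty] := coordinate_ex t (cover_succ j).
rewrite (cover_sigma_familyE ty) => e.
have ij' : cover_le (cover_succ i) (cover_succ j).
  by move: ij; rewrite /cover_le /= ltnS !subSS.
have ty' := coordinate_le ij' ty.
rewrite (cover_sigma_familyE ty').
have [Xy _] := coordinate_eqclass ty.
have : eqclass j x (sigma y).
  by rewrite -e; apply: eqclass_refl; exact: points_sigma.
by move=> [_ ej]; apply/esym/cover_equiv_eqclass/(cover_equiv_le ij).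
Qed.

Definition cover_sigma (t : cover) : cover :=
  SigSub (mem_set (cover_sigma_subproof t)).

Lemma factor_map_subproof (t : cover) : exists x : full_shift A, points X x /\
  forall i y, coordinate t i y -> mkseq x (val i).1 = mkseq y (val i).1.
Proof.
pose diag n : cover_index := exist (fun kl : nat * nat => (kl.1 <= kl.2)%N) (n, n) (leqnn n).
pose r n := projT1 (cid (coordinate_ex t (diag n))).
have rP n : coordinate t (diag n) (r n) := projT2 (cid (coordinate_ex t (diag n))).
pose x : full_shift A := fun n => r n.+1 n.
have xE i y n : (n < (val i).1)%N -> coordinate t i y -> x n = y n.
  move=> ni ty.
  have le_i : cover_le (diag n.+1) i by rewrite /cover_le /= ni subnn.
  have := rP n.+1; have [_ ->] := coordinate_eqclass (coordinate_le le_i ty).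
  move=> [_ [e _]]; have := congr1 (fun s => nth (y 0%N) s n) e.
  by rewrite !nth_mkseq.
exists x; split; last first.
  move=> i y ty; apply: (@eq_from_nth _ (x 0%N)); rewrite ?size_mkseq // => n ni.
  by rewrite !nth_mkseq //; exact: xE ty.
apply: (@closed_cvg _ (full_shift A) \oo _ r _ (@points_closed _ X)).
  by apply: nearW => n; have [] := coordinate_eqclass (rP n).
apply/cvg_sup => n B; rewrite nbhsE => -[W [[V oV <-] Vx] WB].
exists n.+1 => // k /= nk; apply: WB => /=.
by rewrite -(xE (diag k) (r k) n nk (rP k)).
Qed.

Definition factor_map (t : cover) : full_shift A := projT1 (cid (factor_map_subproof t)).

End Cover.

(** * The groupoid *)

Section Groupoid.
Variables (A : finType) (X : shift_space A).

Definition groupoid_set : set (cover X * int * cover X) :=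
  [set g | exists i j : nat, g.1.2 = i%:Z - j%:Z /\
     iter i (@cover_sigma A X) g.1.1 = iter j (@cover_sigma A X) g.2].

Record groupoid := Groupoid {
  triple : cover X * int * cover X;
  tripleP : triple \in groupoid_set
}.
HB.instance Definition _ := [isSub for triple].
HB.instance Definition _ := [Choice of groupoid by <:].

Definition range_of (g : groupoid) : cover X := (triple g).1.1.
Definition degree (g : groupoid) : int := (triple g).1.2.
Definition source_of (g : groupoid) : cover X := (triple g).2.

Definition basic_set (i j : nat) (U V : set (cover X)) : set groupoid :=
  [set g | [/\ U (range_of g), V (source_of g), degree g = i%:Z - j%:Z &
     iter i (@cover_sigma A X) (range_of g) =
     iter j (@cover_sigma A X) (source_of g)]].

Definition basic_sets : set (set groupoid) :=
  [set W | exists i j U V,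
    [/\ open U, open V,
        set_inj U (iter i (@cover_sigma A X)),
        set_inj V (iter j (@cover_sigma A X)) &
        iter i (@cover_sigma A X) @` U = iter j (@cover_sigma A X) @` V] /\
    W = basic_set i j U V].

HB.instance Definition _ := isSubBaseTopological.Build groupoid basic_sets id.

(** [is_product g h k] holds when g and h are composable with product k. *)
Definition is_product (g h k : groupoid) : Prop :=
  [/\ source_of g = range_of h, range_of k = range_of g,
      source_of k = source_of h & degree k = degree g + degree h].

Definition is_unit (g : groupoid) : Prop :=
  degree g = 0 /\ range_of g = source_of g.

End Groupoid.

(** The norm topology of the complex numbers. *)
HB.instance Definition _ (R : realType) := NormedModule.copy R[i] R[i]^o.

(** * The Hilbert space of square-summable functions *)

Section L2.
Variables (R : realType) (S : choiceType).

Definition sqnorm (xi : S -> R[i]) : \bar R :=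
  (\esum_(s in [set: S]) (complex.Re (xi s) ^+ 2 + complex.Im (xi s) ^+ 2)%:E)%R.

Definition square_summable : {pred S -> R[i]} :=
  mem [set xi : S -> R[i] | (sqnorm xi < +oo)%E].

Lemma sqnormZD (a : R[i]) (xi eta : S -> R[i]) c :
  c = (complex.Re a ^+ 2 + complex.Im a ^+ 2) *+ 2 ->
  (sqnorm (a *: xi + eta)%R <= c%:E * sqnorm xi + 2%:E * sqnorm eta)%E.
Proof.
move=> cE.
pose f (zeta : S -> R[i]) s := (complex.Re (zeta s) ^+ 2 + complex.Im (zeta s) ^+ 2)%:E%R.
have c0 : 0 <= c by rewrite cE mulrn_wge0 // addr_ge0 ?sqr_ge0.
have f0 zeta s : (0 <= f zeta s)%E by rewrite lee_fin addr_ge0 ?sqr_ge0.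
apply: ge_ereal_sup => _ [F [finF _] <-].
have sub zeta : (\sum_(s \in F) f zeta s <= sqnorm zeta)%E.
  by apply: ereal_sup_ubound; exists F => //; split.
apply: (@le_trans _ _ (\sum_(s \in F) (c%:E * f xi s + 2%:E * f eta s))%E).
  apply: lee_fsum => // s _.
  rewrite -!EFinM -EFinD lee_fin /=.
  rewrite [(a *: xi + eta)%R s](_ : _ = a * xi s + eta s) //.
  rewrite cE; case: a (xi s) (eta s) {cE c0} => [a b] [u v] [w z] /=.
  have := sqr_ge0 (a * u - b * v - w); have := sqr_ge0 (a * v + b * u - z).
  nra.
rewrite fsbig_split //= -!ge0_mule_fsumr //.
by apply: leeD; apply: lee_wpmul2l; rewrite ?lee_fin.
Qed.

Lemma square_summable_submod : submod_closed square_summable.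
Proof.
split=> [|a xi eta /set_mem /= xioo /set_mem /= etaoo]; apply/mem_set => /=.
  rewrite /sqnorm esum1 ?ltry // => s _ /=.
  by rewrite expr0n /= addr0.
apply: le_lt_trans (sqnormZD xi eta (erefl _)) _.
have sqnorm0 zeta : (0 <= sqnorm zeta)%E.
  by apply: esum_ge0 => s _; rewrite lee_fin addr_ge0 ?sqr_ge0.
by apply: lte_add_pinfty; apply: lte_mul_pinfty;
  rewrite ?lee_fin ?mulrn_wge0 ?addr_ge0 ?sqr_ge0.
Qed.

Record l2 := L2 { l2_fun :> S -> R[i]; l2_funP : l2_fun \in square_summable }.

HB.instance Definition _ := [isSub for l2_fun].
HB.instance Definition _ := [Choice of l2 by <:].
HB.instance Definition _ :=
  GRing.isSubmodClosed.Build _ _ square_summable square_summable_submod.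
HB.instance Definition _ := [SubChoice_isSubLmodule of l2 by <:].

Definition l2norm (xi : l2) : R := Num.sqrt (fine (sqnorm xi)).

(** The sum of an absolutely summable real family. *)
Definition rsum (f : S -> R) : R :=
  fine (\esum_(s in [set: S]) (Num.max (f s) 0)%:E)%R -
  fine (\esum_(s in [set: S]) (Num.max (- f s) 0)%:E)%R.

Definition csum (f : S -> R[i]) : R[i] :=
  rsum (fun s => complex.Re (f s)) +i* rsum (fun s => complex.Im (f s)).

Definition inner (xi eta : l2) : R[i] := csum (fun s => xi s * (eta s)^*%C).

Definition bounded_operator : set (l2 -> l2) :=
  [set T | linear T /\ exists M : R, forall xi, l2norm (T xi) <= M * l2norm xi].

(** [T'] is the adjoint of [T]. *)
Definition adjoint (T T' : l2 -> l2) : Prop :=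
  forall xi eta, inner (T xi) eta = inner xi (T' eta).

Definition norm_closure (D : set (l2 -> l2)) : set (l2 -> l2) :=
  [set T | bounded_operator T /\ forall e : R, 0 < e ->
     exists2 T', D T' & forall xi, l2norm (T xi - T' xi) <= e * l2norm xi].

End L2.

(** [Phi] is only relevant on [D]; [D] and [E] are meant to be *-algebras. *)
Record star_isomorphism (R : realType) (S S' : choiceType)
    (D : set (l2 R S -> l2 R S)) (E : set (l2 R S' -> l2 R S'))
    (Phi : (l2 R S -> l2 R S) -> (l2 R S' -> l2 R S')) : Prop := {
  star_iso_bij : set_bij D E Phi;
  star_iso_linear : forall (a : R[i]) T T', D T -> D T' ->
    Phi (a *: T + T') = a *: Phi T + Phi T';
  star_iso_mul : forall T T', D T -> D T' ->
    Phi (T \o T') = Phi T \o Phi T';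
  star_iso_star : forall T T', D T -> D T' ->
    adjoint T T' -> adjoint (Phi T) (Phi T')
}.

(** * The algebras

    The algebra [OX] is the reduced C*-algebra of the groupoid: C_c(G) acts by
    left convolution on l2(G), the Hilbert sum over the units x of the spaces
    l2(G_x) of functions on the source fibre of x, and [OX] is the closure of
    its image for the operator norm.  The groupoid being amenable, this is also
    its full C*-algebra. *)

Section Algebras.
Variables (R : realType) (A : finType) (X : shift_space A).
Let G := groupoid X.

Definition compactly_supported (f : G -> R[i]) : Prop :=
  exists2 K : set G, compact K & forall g, ~ K g -> f g = 0.

(** For [f] in C_c(G), or supported on the units, only finitely many terms are
    nonzero, because [f] is nonzero at finitely many points of each range fibre. *)
Definition convolution (f xi : G -> R[i]) (g : G) : R[i] :=
  \sum_(p \in [set p : G * G | is_product p.1 p.2 g]) (f p.1 * xi p.2).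

Definition represents (f : G -> R[i]) (T : l2 R G -> l2 R G) : Prop :=
  bounded_operator T /\ forall xi g, T xi g = convolution f xi g.

Definition OX : set (l2 R G -> l2 R G) :=
  norm_closure [set T | exists f : G -> R[i],
    [/\ continuous f, compactly_supported f & represents f T]].

Definition unit_extension (f : cover X -> R[i]) (g : G) : R[i] :=
  if `[< is_unit g >] then f (range_of g) else 0.

Definition DX : set (l2 R G -> l2 R G) :=
  [set T | exists2 f : cover X -> R[i], continuous f &
     represents (unit_extension f) T].

Definition CX : set (l2 R G -> l2 R G) :=
  [set T | exists2 h : full_shift A -> R[i], {within points X, continuous h} &
     represents (unit_extension (h \o @factor_map A X)) T].

End Algebras.

Arguments OX R {A} X.
Arguments DX R {A} X.
Arguments CX R {A} X.

(* Main.v *)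
From mathcomp Require Import all_boot all_order all_algebra finmap.
From mathcomp Require Import complex zify ring lra.
From mathcomp Require Import all_classical all_reals all_analysis.

Require Import Defs.

(** The diagonal is recovered from C(X) inside the C*-algebra, through the relative
    commutant C(X)' of C(X) and the idempotents of that commutant.

    An operator in the algebra of the groupoid has a continuous symbol, the function
    on the groupoid by which it acts through convolution.  If the operator commutes
    with C(X), then around each g = (x, i - j, y) at which the symbol is nonzero, the
    factor map identifies range and source.  For i = j this makes g a unit.  For
    i <> j, the points of X below a neighbourhood of x satisfy sigma^i = sigma^j,
    hence are determined by a prefix of fixed length, and the factor map is locally
    constant at x and at y.  A nonempty open set of the cover on which the factor map
    is constant is a single isolated point, so that x = y is isolated
    ([fibre_preserving], [commutant_symbol]).  Thus the symbols of elements of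
    C(X)' live on the units and on the isotropy groups, which embed into the integers,
    at isolated points of the cover.

    The spectrum of the group algebra of the integers is a circle.  As circles are
    connected, the idempotents of C(X)' are diagonal: they are the indicators 1_U of
    the clopen subsets U of the cover ([idempotent_commutant_DX], [idempotent_DX]).
    Connectedness enters through the gauge action: a norm continuous path of
    commuting idempotents is constant, so idempotents are fixed by the gauge action
    and have degree 0.

    An isomorphism Phi with Phi(C(X)) = C(Y) therefore maps indicators of clopen sets
    to indicators of clopen sets, and it matches the isolated points of the two
    covers, which correspond to minimal indicators ([isolated_preimage],
    [isolated_image]).  If T is diagonal, then Phi T commutes with C(Y), so it could
    fail to be diagonal only over an isolated point y.  But 1_y = Phi 1_x for an
    isolated point x, and T 1_x is a multiple of 1_x, so (Phi T) 1_y is a multiple of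
    1_y ([commutant_DX]).  The converse inclusion follows in the same way from the
    correspondence of isolated points in the other direction. *)

Set Implicit Arguments.
Unset Strict Implicit.
Unset Printing Implicit Defensive.

Import Order.TTheory GRing.Theory Num.Theory.
Import numFieldNormedType.Exports.
Local Open Scope classical_set_scope.
Local Open Scope ring_scope.
Local Open Scope complex_scope.

(** * The shift map and the cover *)

Section CoverCombinatorics.
Variables (A : finType) (X : shift_space A).
Implicit Types (t s : cover X) (x y z : full_shift A).

Local Notation sg := (@cover_sigma A X).
Local Notation pi := (@factor_map A X).

Lemma iter_sigmaE m x n : iter m (@sigma A) x n = x (m + n)%N.
Proof. by elim: m n => // m IH n; rewrite iterS /sigma IH addnS. Qed.

(** Indexing the coordinates by k and d = l - k turns the order on the indices
    into the product order on pairs of natural numbers. *)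
Definition idx (k d : nat) : cover_index :=
  exist (fun kl : nat * nat => (kl.1 <= kl.2)%N) (k, k + d)%N (leq_addr d k).

Lemma idx_sub (i : cover_index) :
  i = idx (val i).1 ((val i).2 - (val i).1).
Proof. by case: i => -[k l] /= h; apply: val_inj; rewrite /= subnKC. Qed.

Lemma idx_le k d k' d' : (k <= k')%N -> (d <= d')%N ->
  cover_le (idx k d) (idx k' d').
Proof. by move=> hk hd; rewrite /cover_le /= !addKn hk hd. Qed.

Lemma idx_succ k d : cover_succ (idx k d) = idx k.+1 d.
Proof. exact: val_inj. Qed.

Lemma mkseq_eqP k x y :
  mkseq x k = mkseq y k <-> forall n, (n < k)%N -> x n = y n.
Proof.
split=> [e n nk|e].
  by have := congr1 (fun w => nth (x 0%N) w n) e; rewrite !nth_mkseq.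
apply: (@eq_from_nth _ (x 0%N)); rewrite ?size_mkseq // => n nk.
by rewrite !nth_mkseq // e.
Qed.

Lemma cover_equiv_trans i x y z :
  cover_equiv X i x y -> cover_equiv X i y z -> cover_equiv X i x z.
Proof. by move=> [e1 e2] [e3 e4]; split; rewrite ?e1 ?e2. Qed.

Lemma coordinateE t i y : coordinate t i y -> coordinate t i = eqclass X i y.
Proof. by case/coordinate_eqclass. Qed.

Lemma coordinate_points t i y : coordinate t i y -> points X y.
Proof. by case/coordinate_eqclass. Qed.

Lemma coordinate_equiv t i y z :
  coordinate t i y -> coordinate t i z -> cover_equiv X i y z.
Proof. by move=> /coordinateE -> []. Qed.

Lemma coordinate_idx_le t k d k' d' y : (k <= k')%N -> (d <= d')%N ->
  coordinate t (idx k' d') y -> coordinate t (idx k d) y.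
Proof. by move=> hk hd; apply: coordinate_le; exact: idx_le. Qed.

Lemma cover_eq t s : (forall k d, coordinate t (idx k d) = coordinate s (idx k d)) ->
  t = s.
Proof.
move=> e; apply: val_inj; apply: functional_extensionality_dep => i.
by rewrite (idx_sub i); exact: e.
Qed.

Lemma coordinate_eq_le t s i j : cover_le i j ->
  coordinate t j = coordinate s j -> coordinate t i = coordinate s i.
Proof.
move=> ij e; have [y ty] := coordinate_ex t j.
have sy : coordinate s j y by rewrite -e.
by rewrite (coordinateE (coordinate_le ij ty)) (coordinateE (coordinate_le ij sy)).
Qed.

Lemma cover_eq_pos t s :
  (forall k d, coordinate t (idx k.+1 d) = coordinate s (idx k.+1 d)) -> t = s.
Proof.
by move=> e; apply: cover_eq => k d; apply: coordinate_eq_le (e k d); exact: idx_le.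
Qed.

Lemma coordinate_sigma t k d y : coordinate t (idx k.+1 d) y ->
  coordinate (sg t) (idx k d) = eqclass X (idx k d) (sigma y).
Proof. by move=> ty; apply: cover_sigma_familyE; rewrite idx_succ. Qed.

Lemma factor_map_points t : points X (pi t).
Proof. by rewrite /factor_map; case: cid => ? []. Qed.

Lemma factor_mapE t k d y n : (n < k)%N -> coordinate t (idx k d) y -> pi t n = y n.
Proof.
rewrite /factor_map; case: cid => x [_ h] /= nk ty.
exact: (proj1 (mkseq_eqP _ _ _) (h _ _ ty)).
Qed.

Lemma factor_map_coordinate t s n :
  coordinate t (idx n.+1 0) = coordinate s (idx n.+1 0) -> pi t n = pi s n.
Proof.
move=> e; have [y ty] := coordinate_ex t (idx n.+1 0).
by rewrite (factor_mapE _ ty) // (@factor_mapE s n.+1 0 y) // -e.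
Qed.

Lemma factor_map_sigma t : pi (sg t) = sigma (pi t).
Proof.
apply/funext => n; have [y ty] := coordinate_ex t (idx n.+2 0).
rewrite /sigma (factor_mapE _ ty) //.
rewrite (@factor_mapE _ n.+1 0 (sigma y)) // (coordinate_sigma ty).
by apply: eqclass_refl; apply: points_sigma; exact: coordinate_points ty.
Qed.

Lemma factor_map_iter m t : pi (iter m sg t) = iter m (@sigma A) (pi t).
Proof. by elim: m => // m IH; rewrite !iterS factor_map_sigma IH. Qed.

Definition cons_shift (a : A) (z : full_shift A) : full_shift A :=
  fun n => if n is m.+1 then z m else a.

Lemma cons_shift_equiv a k d z z' :
  cover_equiv X (idx k d.+1) z z' ->
  cover_equiv X (idx k.+1 d) (cons_shift a z) (cons_shift a z').
Proof.
have it u : iter k.+1 (@sigma A) (cons_shift a u) = iter k (@sigma A) u.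
  by rewrite iterSr.
move=> [/mkseq_eqP e1 e2]; split; first by apply/mkseq_eqP => -[|n] //= /e1.
apply/seteqP; split=> mu /pastsP [smu]; rewrite it => h; apply/pastsP; rewrite it;
  split=> //.
  have /pastsP[] // : pasts X (idx k d.+1) z' mu.
  by rewrite -e2; apply/pastsP; split; rewrite //= addnS -addSn.
have /pastsP[] // : pasts X (idx k d.+1) z mu.
by rewrite e2; apply/pastsP; split; rewrite //= addnS -addSn.
Qed.

Lemma cons_shiftK (y : full_shift A) : cons_shift (y 0%N) (sigma y) = y.
Proof. by apply/funext => -[]. Qed.

(** The first symbol of the image in X is all that the shift of the cover
    forgets: the words preceding the (k+1)-st tail, up to length l, are recorded
    by the (k, l)-coordinate of the image. *)
Lemma cover_sigma_inj t s : sg t = sg s -> pi t 0%N = pi s 0%N -> t = s.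
Proof.
move=> e e0; apply: cover_eq_pos => k d.
have [y ty] := coordinate_ex t (idx k.+1 d.+1).
have [z sz] := coordinate_ex s (idx k.+1 d.+1).
rewrite (coordinateE (coordinate_idx_le (leqnn _) (leqnSn d) ty)).
rewrite (coordinateE (coordinate_idx_le (leqnn _) (leqnSn d) sz)).
apply: cover_equiv_eqclass; rewrite -(cons_shiftK y) -(cons_shiftK z).
rewrite -(factor_mapE _ ty) // -(factor_mapE _ sz) // e0.
apply: cons_shift_equiv.
have [] : eqclass X (idx k d.+1) (sigma y) (sigma z) => //.
rewrite -(coordinate_sigma ty) e (coordinate_sigma sz).
by apply: eqclass_refl; apply: points_sigma; exact: coordinate_points sz.
Qed.

Lemma iter_cover_sigma_inj m t s : iter m sg t = iter m sg s ->
  (forall n, (n < m)%N -> pi t n = pi s n) -> t = s.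
Proof.
elim: m t s => // m IH t s; rewrite !iterSr => e h.
apply: cover_sigma_inj; last exact: h.
by apply: IH => // n nm; rewrite !factor_map_sigma; exact: h.
Qed.

(** The words preceding the k-th tail of sigma y are recorded up to a length at
    which they include the first k + 1 symbols of y, so that the symbol y_0 may
    be put in front of every sequence with the same coordinate as sigma y. *)
Lemma cover_sigma_lift (y : full_shift A) k d s : points X y ->
  coordinate s (idx k d.+1) (sigma y) ->
  exists t, sg t = s /\ coordinate t (idx k.+1 d) y.
Proof.
move=> Xy sy.
have Xcons z : coordinate s (idx k d.+1) z -> points X (cons_shift (y 0%N) z).
  move=> sz; have [/mkseq_eqP e1 e2] := coordinate_equiv sy sz.
  have : pasts X (idx k d.+1) (sigma y) (mkseq y k.+1).
    apply/pastsP; split; first by rewrite size_mkseq /= addnS ltnS leq_addr.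
    suff -> : prepend (mkseq y k.+1) (iter k (@sigma A) (sigma y)) = y by [].
    apply/funext => n; rewrite /prepend size_mkseq -iterSr iter_sigmaE.
    case: (ltnP n k.+1) => nk; first by rewrite nth_mkseq.
    by rewrite nth_default ?size_mkseq // subnKC.
  rewrite e2 => /pastsP[_] /=.
  suff -> : prepend (mkseq y k.+1) (iter k (@sigma A) z) = cons_shift (y 0%N) z by [].
  apply/funext => n; rewrite /prepend size_mkseq iter_sigmaE.
  case: (ltnP n k.+1) => nk.
    by rewrite nth_mkseq //; case: n nk => //= n nk; rewrite -e1.
  by rewrite nth_default ?size_mkseq //; case: n nk => //= n nk; rewrite subSS subnKC.
(* [up i] lies above both i and (k, k + d + 1): below the former the classes of
   the chosen sequences cohere, below the latter y_0 may be prepended. *)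
pose up (i : cover_index) := idx ((val i).1 + k) ((val i).2 - (val i).1 + d.+1).
pose r i := projT1 (cid (coordinate_ex s (up i))).
have rP i : coordinate s (up i) (r i) := projT2 (cid (coordinate_ex s (up i))).
have rk i : coordinate s (idx k d.+1) (r i).
  by apply: coordinate_idx_le (rP i); rewrite leq_addl.
pose T : class_family A := fun i => eqclass X i (cons_shift (y 0%N) (r i)).
have TP : cover_set X T.
  split=> [i|i j x ij Xx e].
    by exists (cons_shift (y 0%N) (r i)) => //; apply: Xcons.
  apply: cover_equiv_eqclass.
  apply: (@cover_equiv_trans _ _ (cons_shift (y 0%N) (r j))); last first.
    apply: (cover_equiv_le ij).
    by have [] : T j x by rewrite e; exact: eqclass_refl.
  move: ij; rewrite (idx_sub i).
  set a := (val i).1; set b := ((val i).2 - (val i).1)%N => ij.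
  apply: (@cover_equiv_le _ _ _ (idx a.+1 b)); first exact: idx_le.
  apply: cons_shift_equiv; apply: (@coordinate_equiv s).
    apply: (@coordinate_idx_le _ _ _ _ _ _ _ _ (rP (idx a b))) => /=; lia.
  move: ij => /andP[/= h1 h2].
  apply: (@coordinate_idx_le _ _ _ _ _ _ _ _ (rP j)) => /=; lia.
exists (SigSub (mem_set TP) : cover X); split; last first.
  rewrite /coordinate /= /T; split=> //; rewrite -[X in cover_equiv _ _ _ X]cons_shiftK.
  by apply: cons_shift_equiv; exact: coordinate_equiv (rk _) sy.
apply: cover_eq => a b.
rewrite (@coordinate_sigma _ _ _ (cons_shift (y 0%N) (r (idx a.+1 b)))); last first.
  by rewrite /coordinate /= /T; apply: eqclass_refl; exact: Xcons.
apply/esym/coordinateE.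
by apply: (@coordinate_idx_le _ _ _ _ _ _ _ _ (rP _)) => /=; lia.
Qed.

Section Lift.
Variables (c : full_shift A) (Xc : points X c).

Lemma lift_subproof : cover_set X (fun i => eqclass X i c).
Proof.
split=> [i|i j x ij Xx e]; first by exists c.
apply/cover_equiv_eqclass/(cover_equiv_le ij).
by have [] : eqclass X j c x by rewrite e; exact: eqclass_refl.
Qed.

(** A section of the factor map; it is not continuous in general, but an open
    fibre of the factor map can only consist of such a point. *)
Definition lift : cover X := SigSub (mem_set lift_subproof).

Lemma coordinate_lift i : coordinate lift i = eqclass X i c.
Proof. by []. Qed.

Lemma factor_map_lift : pi lift = c.
Proof.
apply/funext => n; rewrite (@factor_mapE _ n.+1 0 c) // coordinate_lift.
Qed.

Lemma coordinate_set1_lift t i : coordinate t i `<=` [set c] -> t = lift.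
Proof.
move=> tc; apply: cover_eq => k d.
set i' := idx ((val i).1 + k) ((val i).2 - (val i).1 + d).
have [y ty] := coordinate_ex t i'.
have yc : y = c.
  by apply: tc; apply: (coordinate_le _ ty); rewrite (idx_sub i) idx_le ?leq_addr.
rewrite coordinate_lift -yc; apply: coordinateE; apply: coordinate_le ty.
by rewrite idx_le ?leq_addl.
Qed.

End Lift.

End CoverCombinatorics.

(** * The topology of the cover *)

Section CoverTopology.
Variables (A : finType) (X : shift_space A).
Implicit Types (t s : cover X) (x y z : full_shift A) (U V W : set (cover X)).

Local Notation sg := (@cover_sigma A X).
Local Notation pi := (@factor_map A X).

Lemma class_family_nbhs (p : class_family A) i : nbhs p [set q | q i = p i].
Proof.
have := @proj_continuous cover_index
  (fun=> discrete_topology (set (full_shift A))) i p.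
by move=> /(_ _ (discrete_set1 (p i))).
Qed.

Lemma cover_nbhs_coordinate t i : nbhs t [set s | coordinate s i = coordinate t i].
Proof.
have := @initial_continuous _ _ (set_val : cover X -> class_family A) t.
by move=> /(_ _ (class_family_nbhs (val t) i)).
Qed.

Lemma cover_nbhsP t U :
  nbhs t U <-> exists i, [set s | coordinate s i = coordinate t i] `<=` U.
Proof.
split=> [|[i iU]]; last exact: filterS iU (cover_nbhs_coordinate t i).
pose F : set_system (class_family A) :=
  [set B | exists i, forall s, coordinate s i = coordinate t i -> B (val s)].
have FF : Filter F.
  split=> [|P Q [i iP] [j jQ]|P Q PQ [i iP]].
  - by exists (idx 0 0).
  - exists (idx (maxn (val i).1 (val j).1)
      (maxn ((val i).2 - (val i).1) ((val j).2 - (val j).1))) => s e.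
    split; [apply: iP|apply: jQ]; apply: coordinate_eq_le e.
      by rewrite [X in cover_le X](idx_sub i) idx_le ?leq_maxl.
    by rewrite [X in cover_le X](idx_sub j) idx_le ?leq_maxr.
  - by exists i => s e; apply/PQ/iP.
have Ft : F --> (val t : class_family A).
  apply/cvg_sup => i B; rewrite nbhsE => -[W [[V oV <-] Vx] WB].
  by exists i => s e; apply: WB => /=; rewrite -[_ i]/(coordinate s i) e.
rewrite nbhsE => -[W [[V oV <-] Vx] WU].
have [i iV] := Ft V (open_nbhs_nbhs (conj oV Vx)).
by exists i => s /iV Vs; apply: WU.
Qed.

Lemma cover_openP U : open U <->
  forall t, U t -> exists i, [set s | coordinate s i = coordinate t i] `<=` U.
Proof.
rewrite openE; split=> h t Ut; last by apply/cover_nbhsP; exact: h.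
by apply/cover_nbhsP; exact: h.
Qed.

Lemma open_coordinate i (P : set (full_shift A) -> Prop) :
  open [set t : cover X | P (coordinate t i)].
Proof. by apply/cover_openP => t Pt; exists i => s /= ->. Qed.

Lemma open_factor_map n (P : A -> Prop) : open [set t : cover X | P (pi t n)].
Proof.
by apply/cover_openP => t Pt; exists (idx n.+1 0) => s /factor_map_coordinate /= ->.
Qed.

Lemma open_prefix m t : open [set s | forall n, (n < m)%N -> pi s n = pi t n].
Proof.
apply/cover_openP => s st; exists (idx m 0) => s' /= e n nm.
rewrite -st //; have [y sy] := coordinate_ex s (idx m 0).
by rewrite (factor_mapE nm sy) (@factor_mapE _ _ s' m 0 y) // e.
Qed.

Lemma factor_map_continuous : continuous (pi : cover X -> full_shift A).
Proof.
move=> t; have FF : Filter (pi @ nbhs t) by exact: fmap_filter.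
apply/cvg_sup => n B; rewrite nbhsE => -[W [[V oV <-] Vx] WB].
have := open_factor_map n (eq (pi t n)).
rewrite openE => /(_ t erefl); apply: filterS => s /= e.
by apply: WB; rewrite /= -[X in V X]/(pi s n) -e.
Qed.

Lemma cover_separated t s : t <> s -> exists U, [/\ open U, open (~` U), U t & ~ U s].
Proof.
move=> ts.
have [i ei] : exists i, coordinate t i <> coordinate s i.
  by apply/existsNP => h; apply: ts; apply: cover_eq => k d; exact: h.
exists [set u | coordinate u i = coordinate t i]; split=> //; try exact: nesym.
  exact: (@open_coordinate i (fun c => c = coordinate t i)).
exact: (@open_coordinate i (fun c => c <> coordinate t i)).
Qed.

Lemma cover_sigma_continuous : continuous sg.
Proof.
move=> t U /cover_nbhsP [i iU]; apply/cover_nbhsP; exists (cover_succ i) => s e.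
apply: iU => /=; have [y ty] := coordinate_ex t (cover_succ i).
have sy : coordinate s (cover_succ i) y by rewrite e.
by rewrite /coordinate /= (cover_sigma_familyE ty) (cover_sigma_familyE sy).
Qed.

Lemma iter_cover_sigma_continuous m : continuous (iter m sg).
Proof.
elim: m => [|m IH] t; first exact: cvg_id.
by apply: continuous_comp; [exact: IH|exact: cover_sigma_continuous].
Qed.

(** A cylinder of index (k + 1, l) is mapped onto one of index (k, l), by
    [cover_sigma_lift]. *)
Lemma cover_sigma_open t U : nbhs t U -> nbhs (sg t) (sg @` U).
Proof.
move=> /cover_nbhsP [i iU]; set k := (val i).1; set d := ((val i).2 - (val i).1)%N.
have [y ty] := coordinate_ex t (idx k.+1 d.+1).
apply/cover_nbhsP; exists (idx k d.+1) => s /= es.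
have [|u [us uy]] := @cover_sigma_lift _ X y k d s (coordinate_points ty).
  rewrite es (coordinate_sigma ty); apply: eqclass_refl; apply: points_sigma.
  exact: coordinate_points ty.
exists u => //; apply: iU => /=; rewrite (idx_sub i) -/k -/d.
rewrite (coordinateE (coordinate_idx_le (leqnSn _) (leqnn _) uy)).
by rewrite (coordinateE (coordinate_idx_le (leqnSn _) (leqnSn _) ty)).
Qed.

Lemma iter_cover_sigma_open m t U : nbhs t U -> nbhs (iter m sg t) (iter m sg @` U).
Proof.
elim: m U => [|m IH] U tU /=; first by rewrite image_id.
by have := cover_sigma_open (IH _ tU); rewrite image_comp.
Qed.

Lemma open_image_iter m U : open U -> open (iter m sg @` U).
Proof.
by rewrite !openE => oU _ [t Ut <-]; apply: iter_cover_sigma_open; exact: oU.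
Qed.

Lemma open_preimage_iter m U : open U -> open (iter m sg @^-1` U).
Proof. by move: U; apply/continuousP; exact: iter_cover_sigma_continuous. Qed.

(** A class of index (k, l) is determined by a word of length k and a set of
    words of length at most l. *)
Lemma finite_eqclasses i : finite_set [set eqclass X i x | x in points X].
Proof.
set k := (val i).1; set l := (val i).2.
pose W : finType := {m : 'I_l.+1 & m.-tuple A}.
pose code x : {ffun 'I_k -> A} * {ffun W -> bool} :=
  ([ffun n : 'I_k => x n : A],
   [ffun w : W => `[< points X (prepend (tagged w) (iter k (@sigma A) x)) >]]).
have codeP x y : code x = code y -> cover_equiv X i x y.
  move=> [/ffunP e1 /ffunP e2]; split.
    by apply/mkseq_eqP => n nk; have := e1 (Ordinal nk); rewrite !ffunE.
  have sub x' y' :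
      (forall w : W, points X (prepend (tagged w) (iter k (@sigma A) x')) ->
         points X (prepend (tagged w) (iter k (@sigma A) y'))) ->
      pasts X i x' `<=` pasts X i y'.
    move=> h mu /pastsP [smu Xmu]; apply/pastsP; split=> //.
    pose w : W := @Tagged 'I_l.+1 (Ordinal (smu : (size mu < l.+1)%N))
      (fun m : 'I_l.+1 => m.-tuple A) (in_tuple mu).
    exact: (h w).
  apply/seteqP; split; apply: sub => w h.
    by have := e2 w; rewrite !ffunE => e; apply/asboolP; rewrite -e; apply/asboolP.
  by have := e2 w; rewrite !ffunE => e; apply/asboolP; rewrite e; apply/asboolP.
pose g c := \bigcup_(x in [set x | points X x /\ code x = c]) eqclass X i x.
apply: (@sub_finite_set _ _ (g @` setT)); last exact: finite_image.
move=> _ [x Xx <-]; exists (code x) => //.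
apply/seteqP; split=> [y [z [Xz /codeP e]]|y].
  by rewrite (cover_equiv_eqclass e).
by exists x.
Qed.

Lemma closed_cover_set : closed (@cover_set A X).
Proof.
rewrite -[cover_set X]setCK closedC openE => p np.
have [[i hi]|h] := pselect (exists i, ~ exists2 x, points X x & p i = eqclass X i x).
  apply: filterS (class_family_nbhs p i) => q /= e [+ _] => /(_ i) [x Xx].
  by rewrite e => qx; apply: hi; exists x.
have [[i [j [x [ij Xx ex nx]]]]|h'] := pselect (exists i j x,
    [/\ cover_le i j, points X x, p j = eqclass X j x & p i <> eqclass X i x]).
  apply: filterS (filterI (class_family_nbhs p i) (class_family_nbhs p j)).
  by move=> q /= [ei ej] [_ /(_ i j x ij Xx)]; rewrite ei ej => /(_ ex).
exfalso; apply: np; split=> [i|i j x ij Xx ex].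
  by apply: contrapT => hi; apply: h; exists i.
by apply: contrapT => nx; apply: h'; exists i, j, x.
Qed.

(** Being a closed subset of a product of finite sets, the cover is compact. *)
Lemma compact_cover_space : compact [set: cover X].
Proof.
pose P : set (class_family A) :=
  [set p | forall i, [set eqclass X i x | x in points X] (p i)].
have cP : compact P.
  apply: (@tychonoff cover_index (fun=> discrete_topology (set (full_shift A)))
    (fun i => [set eqclass X i x | x in points X])) => i.
  by apply: finite_compact; exact: finite_eqclasses.
have cC : compact (@cover_set A X).
  apply: (subclosed_compact (@closed_cover_set) cP) => p [h _] i.
  by have [x Xx ->] := h i; exists x.
move=> F FF _.
have FC : (val @ F) (@cover_set A X).
  by apply: (@filterS _ F _ setT _ _ filterT) => t _; exact: set_mem (valP t).
have [p [Cp clp]] := cC (val @ F) (fmap_proper_filter _ FF) FC.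
exists (SigSub (mem_set Cp) : cover X); split=> // P' Q FP /cover_nbhsP [i iQ].
have [|_ [[s Ps <-] e]] := clp (val @` P') _ _ (class_family_nbhs p i).
  by apply: (@filterS _ F _ _ _ _ FP) => s Ps; exists s.
by exists s; split=> //; apply: iQ.
Qed.

(** An open set on which the factor map takes a single value c contains a whole
    class of points of X, which can then only be {c}. *)
Lemma factor_map_isolated t U : nbhs t U -> (forall s, U s -> pi s = pi t) ->
  nbhs t [set t] /\ t = lift (factor_map_points t).
Proof.
move=> /cover_nbhsP [i iU] h.
have sub : coordinate t i `<=` [set pi t].
  move=> y ty; have Xy := coordinate_points ty.
  rewrite -(factor_map_lift Xy) /=; apply: h; apply: iU => /=.
  by rewrite coordinate_lift (coordinateE ty).
split; last exact: coordinate_set1_lift sub.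
apply/cover_nbhsP; exists i => s /= e.
rewrite (coordinate_set1_lift (factor_map_points t) sub).
by apply: (@coordinate_set1_lift _ _ _ _ s i); rewrite e.
Qed.

End CoverTopology.

(** Both points are periodic from position i on, with period j - i. *)
Lemma eventually_periodic_eq (A : finType) (x y : full_shift A) i j : (i < j)%N ->
  iter i (@sigma A) x = iter j (@sigma A) x ->
  iter i (@sigma A) y = iter j (@sigma A) y ->
  (forall n, (n < j)%N -> x n = y n) -> x = y.
Proof.
move=> ij ex ey h; apply/funext => n; elim/ltn_ind: n => n IH.
have [/h //|jn] := ltnP n j.
have per z : iter i (@sigma A) z = iter j (@sigma A) z -> z n = z (i + (n - j))%N.
  move=> /(congr1 (fun w : full_shift A => w (n - j)%N)).
  by rewrite !iter_sigmaE subnKC.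
rewrite (per x ex) (per y ey); apply: IH; lia.
Qed.

(** * The groupoid *)

Section GroupoidFacts.
Variables (A : finType) (X : shift_space A).
Local Notation G := (groupoid X).
Implicit Types (g h k : G) (x y : cover X) (U V : set (cover X)).

Local Notation sg := (@cover_sigma A X).
Local Notation pi := (@factor_map A X).

Lemma groupoid_eq g h : range_of g = range_of h -> degree g = degree h ->
  source_of g = source_of h -> g = h.
Proof.
rewrite /range_of /degree /source_of => e1 e2 e3; apply: val_inj => /=.
by case: (triple g) (triple h) e1 e2 e3 => [[a b] c] [[a' b'] c'] /= -> -> ->.
Qed.

Lemma groupoid_ex x p y : groupoid_set (x, p, y) ->
  exists g, [/\ range_of g = x, degree g = p & source_of g = y].
Proof. by move=> h; exists (Groupoid (mem_set h)). Qed.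

Lemma groupoid_iter g : exists i j : nat, degree g = i%:Z - j%:Z /\
  iter i sg (range_of g) = iter j sg (source_of g).
Proof. exact: set_mem (tripleP g). Qed.

Lemma inverse_ex g : exists h,
  [/\ range_of h = source_of g, degree h = - degree g & source_of h = range_of g].
Proof.
apply: groupoid_ex; have [i [j [e1 e2]]] := groupoid_iter g.
by exists j, i; rewrite /= e1 opprB.
Qed.

Lemma product_ex g h : source_of g = range_of h -> exists k, is_product g h k.
Proof.
move=> gh; have [i [j [e1 e2]]] := groupoid_iter g.
have [i' [j' [e3 e4]]] := groupoid_iter h.
have [|k [k1 k2 k3]] := @groupoid_ex (range_of g) (degree g + degree h) (source_of h).
  exists (i' + i)%N, (j + j')%N => /=; split; first by rewrite e1 e3; lia.
  by rewrite iterD e2 -iterD addnC iterD gh e4 -iterD.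
by exists k.
Qed.

Lemma product_uniql g g' h k : is_product g h k -> is_product g' h k -> g = g'.
Proof.
move=> [a1 a2 a3 a4] [b1 b2 b3 b4]; apply: groupoid_eq; [congruence| |congruence].
by apply: (addIr (degree h)); rewrite -a4.
Qed.

Lemma product_uniqr g h h' k : is_product g h k -> is_product g h' k -> h = h'.
Proof.
move=> [a1 a2 a3 a4] [b1 b2 b3 b4]; apply: groupoid_eq; [congruence| |congruence].
by apply: (addrI (degree g)); rewrite -a4.
Qed.

Lemma left_quotient_ex k g : range_of g = range_of k -> exists h, is_product k h g.
Proof.
move=> gk; have [k' [k1 k2 k3]] := inverse_ex k.
have [|h [h1 h2 h3 h4]] := @product_ex k' g; first by rewrite k3.
by exists h; split; rewrite ?h2 ?h4 ?k2 //; lia.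
Qed.

Lemma right_quotient_ex h g : source_of g = source_of h -> exists k, is_product k h g.
Proof.
move=> gh; have [h' [h1 h2 h3]] := inverse_ex h.
have [|k [k1 k2 k3 k4]] := @product_ex g h'; first by rewrite h1.
by exists k; split; rewrite ?k2 ?k3 ?k4 ?h2 ?h3 //; lia.
Qed.

Lemma unit_at_subproof x : (x, 0, x) \in @groupoid_set A X.
Proof. by apply: mem_set; exists 0%N, 0%N; rewrite subrr. Qed.

Definition unit_at x : G := Groupoid (unit_at_subproof x).

Lemma is_unit_at x : is_unit (unit_at x). Proof. by []. Qed.

Lemma is_unitE g : is_unit g -> g = unit_at (range_of g).
Proof. by move=> [e1 e2]; apply: groupoid_eq. Qed.

Lemma unit_at_range g : is_product (unit_at (range_of g)) g g.
Proof. by split; rewrite //= add0r. Qed.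

Lemma product_unit_at g : is_product g (unit_at (source_of g)) g.
Proof. by split; rewrite //= addr0. Qed.

(** ** Neighbourhoods in the groupoid *)

Definition basic_data i j U V := [/\ open U, open V, set_inj U (iter i sg),
  set_inj V (iter j sg) & iter i sg @` U = iter j sg @` V].

Lemma iter_inj_nbhs m x : exists U, [/\ open U, U x & set_inj U (iter m sg)].
Proof.
exists [set s | forall n, (n < m)%N -> pi s n = pi x n]; split=> //.
  exact: open_prefix.
move=> s s' /set_mem hs /set_mem hs' e; apply: iter_cover_sigma_inj e _ => n nm.
by rewrite hs ?hs'.
Qed.

(** Two injectivity neighbourhoods are shrunk to the preimages of the
    intersection of their open images. *)
Lemma basic_nbhs g i j U V : degree g = i%:Z - j%:Z ->
  iter i sg (range_of g) = iter j sg (source_of g) ->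
  nbhs (range_of g) U -> nbhs (source_of g) V ->
  exists U' V', [/\ basic_data i j U' V', U' `<=` U, V' `<=` V & basic_set i j U' V' g].
Proof.
move=> dg eg nU nV.
have [U1 [oU1 U1g iU1]] := iter_inj_nbhs i (range_of g).
have [V1 [oV1 V1g iV1]] := iter_inj_nbhs j (source_of g).
pose U2 := U1 `&` interior U; pose V2 := V1 `&` interior V.
have oU2 : open U2 by apply: openI => //; exact: open_interior.
have oV2 : open V2 by apply: openI => //; exact: open_interior.
pose W := (iter i sg @` U2) `&` (iter j sg @` V2).
have oW : open W by apply: openI; exact: open_image_iter.
have gU2 : U2 (range_of g) by split.
have gV2 : V2 (source_of g) by split.
have gW : W (iter i sg (range_of g)).
  by split; [exists (range_of g)|exists (source_of g)].
exists (U2 `&` iter i sg @^-1` W), (V2 `&` iter j sg @^-1` W); split.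
- split.
  + by apply: openI => //; exact: open_preimage_iter.
  + by apply: openI => //; exact: open_preimage_iter.
  + by move=> s s' /set_mem [[? _] _] /set_mem [[? _] _]; apply: iU1; exact: mem_set.
  + by move=> s s' /set_mem [[? _] _] /set_mem [[? _] _]; apply: iV1; exact: mem_set.
  + apply/seteqP; split=> _ [s [s2 [[a a2 ea] [b b2 eb]]] <-].
      exists b => //; split=> //.
      by split; [exists a => //; rewrite ea|exists b]; rewrite ?eb.
    by exists a => //; split=> //; split; [exists a|exists b => //; rewrite eb ea].
- by move=> s [[_ /interior_subset]].
- by move=> s [[_ /interior_subset]].
- by split=> //; split=> //=; rewrite -eg.
Qed.

Lemma basic_nbhsI g i j U V i' j' U' V' :
  basic_data i j U V -> basic_set i j U V g ->
  basic_data i' j' U' V' -> basic_set i' j' U' V' g ->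
  exists i2 j2 U2 V2, [/\ basic_data i2 j2 U2 V2, basic_set i2 j2 U2 V2 g &
    basic_set i2 j2 U2 V2 `<=` basic_set i j U V `&` basic_set i' j' U' V'].
Proof.
wlog ii' : i j U V i' j' U' V' / (i <= i')%N.
  move=> hw b bg b' bg'; case: (leqP i i') => [|/ltnW] ii'.
    exact: hw ii' b bg b' bg'.
  have [i2 [j2 [U2 [V2 [h1 h2 h3]]]]] := hw _ _ _ _ _ _ _ _ ii' b' bg' b bg.
  by exists i2, j2, U2, V2; split=> //; rewrite setIC.
move=> [oU oV _ _ _] [gU gV dg eg] [oU' oV' _ _ _] [gU' gV' dg' eg'].
have [||U2 [V2 [b sU sV bg]]] := @basic_nbhs g i j (U `&` U') (V `&` V') dg eg.
- by apply: open_nbhs_nbhs; split=> //; exact: openI.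
- by apply: open_nbhs_nbhs; split=> //; exact: openI.
exists i, j, U2, V2; split=> // h [hU hV dh eh].
have [? ?] := sU _ hU; have [? ?] := sV _ hV.
split; split=> //; first by rewrite dh -dg.
have -> : i' = (i' - i + i)%N by rewrite subnK.
have -> : j' = (i' - i + j)%N by move: dg'; rewrite dg; lia.
by rewrite !iterD eh.
Qed.

Lemma basic_set_open i j U V : basic_data i j U V -> open (basic_set i j U V).
Proof.
move=> b; exists [set basic_set i j U V]; last by rewrite bigcup_set1.
by move=> _ ->; apply: finI_from1; exists i, j, U, V.
Qed.

(** The basic sets form a base: of two descriptions of the same element, the one
    with the smaller exponents imposes the stronger condition. *)
Lemma groupoid_nbhsP g (N : set G) : nbhs g N -> exists i j U V,
  [/\ basic_data i j U V, basic_set i j U V g & basic_set i j U V `<=` N].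
Proof.
rewrite nbhsE => -[W [[C sC <-] [B CB Bg]] WN].
suff [i [j [U [V [b bg bB]]]]] : exists i j U V,
    [/\ basic_data i j U V, basic_set i j U V g & basic_set i j U V `<=` B].
  by exists i, j, U, V; split=> // h /bB Bh; apply: WN; exists B.
have [D sD DB] := sC _ CB; move: Bg; rewrite -DB => gD.
have {sD} sD w : w \in (D : seq _) -> basic_sets w by move=> /sD /set_mem.
suff [i [j [U [V [b bg bs]]]]] : exists i j U V, [/\ basic_data i j U V,
    basic_set i j U V g & forall w, w \in (D : seq _) -> basic_set i j U V `<=` w].
  by exists i, j, U, V; split=> // h bh w wD; exact: bs bh.
have {gD} gD w : w \in (D : seq _) -> w g by move=> wD; exact: gD.
elim: (D : seq _) sD gD => [_ _|w s IH sub gs].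
  have [i [j [dg eg]]] := groupoid_iter g.
  have [U [V [b _ _ bg]]] := basic_nbhs dg eg filterT filterT.
  by exists i, j, U, V.
have [||i [j [U [V [b bg bs]]]]] := IH.
- by move=> v vs; apply: sub; rewrite in_cons vs orbT.
- by move=> v vs; apply: gs; rewrite in_cons vs orbT.
have [i' [j' [U' [V' [b' wE]]]]] := sub w (mem_head _ _).
have [|i2 [j2 [U2 [V2 [h1 h2 h3]]]]] := @basic_nbhsI g _ _ _ _ _ _ _ _ b bg b'.
  by rewrite -wE; apply: gs; exact: mem_head.
exists i2, j2, U2, V2; split=> // v.
rewrite in_cons => /orP[/eqP -> h /h3 [_]|vs h /h3 [hs _]].
  by rewrite wE.
exact: bs vs _ hs.
Qed.

Lemma range_of_continuous : continuous (@range_of A X).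
Proof.
move=> g N nN; have [i [j [dg eg]]] := groupoid_iter g.
have [U [V [b UN _ bg]]] := basic_nbhs dg eg nN filterT.
apply: (@filterS _ _ _ (basic_set i j U V)); first by move=> h [/UN].
by apply: open_nbhs_nbhs; split=> //; exact: basic_set_open.
Qed.

Lemma source_of_continuous : continuous (@source_of A X).
Proof.
move=> g N nN; have [i [j [dg eg]]] := groupoid_iter g.
have [U [V [b _ VN bg]]] := basic_nbhs dg eg filterT nN.
apply: (@filterS _ _ _ (basic_set i j U V)); first by move=> h [_ /VN].
by apply: open_nbhs_nbhs; split=> //; exact: basic_set_open.
Qed.

Lemma degree_nbhs g : nbhs g [set h | degree h = degree g].
Proof.
have [i [j [dg eg]]] := groupoid_iter g.
have [U [V [b _ _ bg]]] := basic_nbhs dg eg filterT filterT.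
apply: (@filterS _ _ _ (basic_set i j U V)).
  by move=> h [_ _ /= -> _]; rewrite dg.
by apply: open_nbhs_nbhs; split=> //; exact: basic_set_open.
Qed.

Lemma range_of_open g (N : set G) : nbhs g N -> nbhs (range_of g) (@range_of A X @` N).
Proof.
move=> /groupoid_nbhsP [i [j [U [V [[oU oV _ _ UV] [gU gV dg eg] sN]]]]].
apply: (@filterS _ _ _ U); last exact: open_nbhs_nbhs.
move=> z Uz; have : (iter j sg @` V) (iter i sg z) by rewrite -UV; exists z.
move=> [w Vw zw]; have [|h [h1 h2 h3]] := @groupoid_ex z (degree g) w.
  by exists i, j.
by exists h => //; apply: sN; split; rewrite ?h1 ?h2 ?h3.
Qed.

Lemma unit_at_continuous : continuous unit_at.
Proof.
move=> x N /groupoid_nbhsP [i [j [U [V [[oU oV _ _ _] [gU gV dg eg] sN]]]]].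
apply: (@filterS _ _ _ (U `&` V)); last first.
  by apply: open_nbhs_nbhs; split; [exact: openI|split].
move=> y [Uy Vy]; apply: sN; split=> //.
by have -> : i = j by move: dg; rewrite /degree /=; lia.
Qed.

Lemma unit_nbhs g : is_unit g -> nbhs g (@is_unit A X).
Proof.
move=> [dg eg].
have [||||U [V [b _ _ bg]]] := @basic_nbhs g 0 0 setT setT; rewrite ?dg ?eg ?subrr //;
  try exact: filterT.
apply: (@filterS _ _ _ (basic_set 0 0 U V)).
  by move=> h [_ _ dh eh]; split; rewrite // dh subrr.
by apply: open_nbhs_nbhs; split=> //; exact: basic_set_open.
Qed.

Lemma nonunit_nbhs g : ~ is_unit g -> nbhs g [set h | ~ is_unit h].
Proof.
move=> ng; have [dg|dg] := eqVneq (degree g) 0; last first.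
  by apply: filterS (degree_nbhs g) => h /= dh [/eqP]; rewrite dh (negbTE dg).
have /cover_separated [U [oU oU' Ug nUg]] : range_of g <> source_of g.
  by move=> eg; apply: ng.
have nr : nbhs g (@range_of A X @^-1` U).
  by apply: range_of_continuous; exact: open_nbhs_nbhs.
have ns : nbhs g (@source_of A X @^-1` ~` U).
  by apply: source_of_continuous; exact: open_nbhs_nbhs.
by apply: filterS (filterI nr ns) => h [/= h1 h2] [_ e]; apply: h2; rewrite -e.
Qed.

Lemma compact_units : compact (range unit_at).
Proof.
apply: continuous_compact; last exact: compact_cover_space.
exact: continuous_subspaceT unit_at_continuous.
Qed.

Lemma compact_degree (K : set G) : compact K ->
  exists N, forall g, K g -> (`|degree g| <= N)%N.
Proof.
move=> /compact_near_coveringP /(_ nat \oo (fun n g => (`|degree g| <= n)%N)) [].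
- move=> g _; exists ([set h | degree h = degree g], [set n | (`|degree g| <= n)%N]).
    by split; [exact: degree_nbhs|exists `|degree g|%N].
  by move=> [h n] [/= -> ].
move=> N _ h; exists N => g; exact: (h N (leqnn _)).
Qed.

(** ** Elements that the factor map makes trivial *)

(** The points of X below U are eventually periodic with fixed preperiod and
    period, hence determined by a prefix of fixed length, so that the factor map
    is locally constant at x. *)
Lemma periodic_isolated i j U x : i != j -> nbhs x U ->
  (forall z, U z -> iter i (@sigma A) (pi z) = iter j (@sigma A) (pi z)) ->
  nbhs x [set x] /\ x = lift (factor_map_points x).
Proof.
move=> ij nU hU; pose m := maxn i j.
have nW : nbhs x (U `&` [set s | forall n, (n < m)%N -> pi s n = pi x n]).
  apply: filterI => //; apply: open_nbhs_nbhs; split=> //; exact: open_prefix.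
apply: (factor_map_isolated nW) => s [Us /= sx].
have Ux := nbhs_singleton nU.
case: (ltngtP i j) ij sx => // [lt|lt] _; rewrite /m.
  rewrite (maxn_idPr (ltnW lt)) => sx.
  exact: eventually_periodic_eq lt (hU _ Us) (hU _ Ux) sx.
rewrite (maxn_idPl (ltnW lt)) => sx.
exact: eventually_periodic_eq lt (esym (hU _ Us)) (esym (hU _ Ux)) sx.
Qed.

(** Write g = (x, i - j, y).  On the basic neighbourhoods U of x and V of y, the
    points of X below satisfy sigma^i = sigma^j.  If i = j then x and y have the
    same image under the i-th iterate and the same prefix, hence agree.  Otherwise
    [periodic_isolated] applies on both sides, and x and y are the lifts of the
    same point of X. *)
Lemma fibre_preserving g : nbhs g [set h | pi (range_of h) = pi (source_of h)] ->
  is_unit g \/ range_of g = source_of g /\ nbhs (range_of g) [set range_of g].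
Proof.
move=> ng; have pg := nbhs_singleton ng.
have [i [j [U [V [[oU oV _ _ UV] [gU gV dg eg] sN]]]]] := groupoid_nbhsP ng.
have [ij|ij] := eqVneq i j.
  left; split; first by rewrite dg ij subrr.
  by move: eg; rewrite ij => /iter_cover_sigma_inj; apply=> n _; rewrite pg.
have pair z w : U z -> V w -> iter i sg z = iter j sg w -> pi z = pi w.
  move=> Uz Vw e; have [|h [h1 h2 h3]] := @groupoid_ex z (degree g) w.
    by exists i, j.
  by have := sN h; rewrite /= /basic_set /= h1 h2 h3; apply.
right; have [||ir er] := @periodic_isolated i j U (range_of g) ij.
- exact: open_nbhs_nbhs.
- move=> z Uz; have : (iter j sg @` V) (iter i sg z) by rewrite -UV; exists z.
  move=> [w Vw wz]; rewrite {2}(pair z w Uz Vw) // -!factor_map_iter.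
  by rewrite wz.
have [||isos es] := @periodic_isolated i j V (source_of g) ij.
- exact: open_nbhs_nbhs.
- move=> w Vw; have : (iter i sg @` U) (iter j sg w) by rewrite UV; exists w.
  move=> [z Uz zw]; rewrite -{1}(pair z w Uz Vw) // -!factor_map_iter.
  by rewrite zw.
split=> //; rewrite er es; apply: cover_eq => k d.
by rewrite !coordinate_lift pg.
Qed.

(** An element whose range and source are x is determined by its degree. *)
Lemma isotropy_isolated g x : nbhs x [set x] -> range_of g = x -> source_of g = x ->
  nbhs g [set g].
Proof.
move=> nx rg sgx.
have nr : nbhs g (@range_of A X @^-1` [set x]).
  by apply: range_of_continuous; rewrite rg.
have ns : nbhs g (@source_of A X @^-1` [set x]).
  by apply: source_of_continuous; rewrite sgx.
apply: filterS (filterI (degree_nbhs g) (filterI nr ns)) => h [/= h1 [h2 h3]].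
by apply: groupoid_eq; rewrite ?h1 ?h2 ?h3 ?rg ?sgx.
Qed.

End GroupoidFacts.

(** * Operators on the space of square-summable functions *)

Section SquareSummable.
Variables (R : realType) (S : choiceType).
Local Notation l2S := (l2 R S).
Implicit Types (xi eta : l2S) (g h : S) (T : l2S -> l2S) (a c : R[i]).

Definition sqmod (a : R[i]) : R := complex.Re a ^+ 2 + complex.Im a ^+ 2.

Lemma sqmod_ge0 a : 0 <= sqmod a.
Proof. by rewrite addr_ge0 ?sqr_ge0. Qed.

Lemma sqmodM a c : sqmod (a * c) = sqmod a * sqmod c.
Proof. by case: a => [u v]; case: c => [w z]; rewrite /sqmod /=; ring. Qed.

Lemma normE a : `|a| = (Num.sqrt (sqmod a))%:C.
Proof. by case: a. Qed.

Lemma norm_le_sqmod a (M : R) : 0 <= M -> (`|a| <= M%:C) = (sqmod a <= M ^+ 2).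
Proof.
move=> M0; rewrite normE lecR -[RHS]ler_sqrt ?sqr_ge0 //.
by rewrite sqrtr_sqr ger0_norm.
Qed.

Lemma sqnormE (f : S -> R[i]) :
  sqnorm f = (\esum_(s in [set: S]) (sqmod (f s))%:E)%R.
Proof. by []. Qed.

Lemma sqnorm_ge0 (f : S -> R[i]) : (0 <= sqnorm f)%E.
Proof. by apply: esum_ge0 => s _; rewrite lee_fin sqmod_ge0. Qed.

Lemma l2norm_ge0 xi : 0 <= l2norm xi.
Proof. exact: sqrtr_ge0. Qed.

Lemma sqnorm_l2 xi : sqnorm xi = (l2norm xi ^+ 2)%:E.
Proof.
have fin : (sqnorm xi < +oo)%E by exact: set_mem (l2_funP xi).
rewrite sqr_sqrtr ?fine_ge0 ?sqnorm_ge0 // fineK // ge0_fin_numE //.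
exact: sqnorm_ge0.
Qed.

Lemma l2norm_le xi (M : R) : 0 <= M -> (sqnorm xi <= (M ^+ 2)%:E)%E -> l2norm xi <= M.
Proof. by move=> M0; rewrite sqnorm_l2 lee_fin ler_pXn2r ?nnegrE ?l2norm_ge0. Qed.

Lemma l2_ext xi eta : (forall g, xi g = eta g) -> xi = eta.
Proof. by move=> e; apply: val_inj; apply/funext. Qed.

Lemma op_ext T T' : (forall xi g, T xi g = T' xi g) -> T = T'.
Proof. by move=> e; apply/funext => xi; apply: l2_ext. Qed.

Lemma l2_linE a xi eta g : (a *: xi + eta) g = a * xi g + eta g.
Proof. by []. Qed.

Lemma l2_subE xi eta g : (xi - eta) g = xi g - eta g.
Proof. by []. Qed.

Lemma sqmod_le_sqnorm (f : S -> R[i]) g : ((sqmod (f g))%:E <= sqnorm f)%E.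
Proof.
rewrite sqnormE -(esum_set1 (a := fun s => (sqmod (f s))%:E)) ?lee_fin ?sqmod_ge0 //.
by apply: le_ereal_sup => _ [F [Ff FS] <-]; exists F => //; split.
Qed.

Lemma norm_eval_le xi g : `|xi g| <= (l2norm xi)%:C.
Proof.
rewrite norm_le_sqmod ?l2norm_ge0 // -lee_fin -sqnorm_l2.
exact: sqmod_le_sqnorm.
Qed.

Lemma l2norm_eq0 xi : l2norm xi = 0 -> xi = 0.
Proof.
move=> e; apply: l2_ext => g; apply/eqP; rewrite -normr_le0.
by have := norm_eval_le xi g; rewrite e.
Qed.

(** The factor 2 makes this weaker than the triangle inequality; the difference
    does not matter for limits. *)
Lemma l2norm_lin a xi eta :
  l2norm (a *: xi + eta) <= 2 * (Num.sqrt (sqmod a) * l2norm xi + l2norm eta).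
Proof.
apply: l2norm_le.
  by rewrite mulr_ge0 // addr_ge0 ?mulr_ge0 ?sqrtr_ge0 ?l2norm_ge0.
have h : (sqnorm (l2_fun (a *: xi + eta)%R) <= _)%E :=
  @sqnormZD R S a xi eta _ (erefl _).
apply: le_trans h _.
rewrite !sqnorm_l2 -!EFinM -EFinD lee_fin -/(sqmod a) -{1}(sqr_sqrtr (sqmod_ge0 a)).
have := sqrtr_ge0 (sqmod a); have := l2norm_ge0 xi; have := l2norm_ge0 eta.
move: (Num.sqrt _) (l2norm xi) (l2norm eta) => u v w w0 v0 u0.
have -> : u ^+ 2 *+ 2 * v ^+ 2 + 2 * w ^+ 2 =
  (2 * (u * v + w)) ^+ 2 - (4 * (u * v * w) *+ 2 + 2 * ((u * v) ^+ 2 + w ^+ 2)) by ring.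
by rewrite gerBl addr_ge0 ?mulrn_wge0 // mulr_ge0 ?addr_ge0 ?sqr_ge0 ?mulr_ge0.
Qed.

Lemma sqmod1 : sqmod 1 = 1. Proof. by rewrite /sqmod /= expr1n expr0n addr0. Qed.
Lemma sqmod0 : sqmod 0 = 0. Proof. by rewrite /sqmod /= expr0n addr0. Qed.
Lemma l2norm_add xi eta : l2norm (xi + eta) <= 2 * (l2norm xi + l2norm eta).
Proof. by have := l2norm_lin 1 xi eta; rewrite scale1r sqmod1 sqrtr1 mul1r. Qed.

Lemma l2normN xi : l2norm (- xi) = l2norm xi.
Proof.
congr (Num.sqrt (fine _)); apply: eq_esum => s _.
by rewrite [(- xi) s](_ : _ = - xi s) //; case: (xi s) => u v /=; rewrite !sqrrN.
Qed.

(** ** Weighted composition operators *)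

(** Functions that are not square summable are sent to 0. *)
Definition to_l2 : (S -> R[i]) -> l2S := locked (insubd 0).

(** Multiplication operators, the unitaries of the gauge action and translations
    by isotropy elements all have this form. *)
Definition weighted_comp (c : S -> R[i]) (phi : S -> S) (xi : l2S) : l2S :=
  to_l2 (fun s => c s * xi (phi s)).

Definition contractive_comp (c : S -> R[i]) (phi : S -> S) :=
  (forall s, sqmod (c s) <= 1) /\ {in [pred s | c s != 0] &, injective phi}.

Lemma sqnorm_comp (c : S -> R[i]) phi xi : contractive_comp c phi ->
  (sqnorm (fun s => c s * xi (phi s))%R <= sqnorm xi)%E.
Proof.
move=> [c1 inj]; pose D := [set s | c s != 0].
apply: (@le_trans _ _ (\esum_(s in D) (sqmod (xi (phi s)))%:E)%R).
  rewrite sqnormE [leRHS]esum_mkcond; apply: le_esum => s _.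
  case: ifPn => [_|]; rewrite lee_fin sqmodM.
    by rewrite ler_piMl ?sqmod_ge0.
  by rewrite notin_setE => /negP; rewrite negbK => /eqP ->; rewrite sqmod0 mul0r.
rewrite -(@esum_image _ _ _ D phi (fun s => (sqmod (xi s))%:E)).
  by apply: le_ereal_sup => _ [F [Ff FS] <-]; exists F => //; split.
by move=> s s' /set_mem Ds /set_mem Ds'; exact: inj.
Qed.

Lemma weighted_compE (c : S -> R[i]) phi xi s : contractive_comp c phi ->
  weighted_comp c phi xi s = c s * xi (phi s).
Proof.
move=> h; rewrite /weighted_comp /to_l2 -lock -[LHS]/(val _ _) insubdK //.
apply/mem_set => /=; apply: le_lt_trans (sqnorm_comp _ h) _.
by rewrite sqnorm_l2 ltry.
Qed.

Lemma weighted_comp_norm (c : S -> R[i]) phi xi : contractive_comp c phi ->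
  l2norm (weighted_comp c phi xi) <= l2norm xi.
Proof.
move=> h; apply: l2norm_le; first exact: l2norm_ge0.
rewrite -sqnorm_l2; apply: le_trans _ (sqnorm_comp xi h).
rewrite le_eqVlt; apply/orP; left; apply/eqP; congr sqnorm.
by apply/funext => s; exact: weighted_compE.
Qed.

Lemma weighted_comp_bounded (c : S -> R[i]) phi : contractive_comp c phi ->
  bounded_operator (weighted_comp c phi).
Proof.
move=> h; split=> [a xi eta|].
  by apply: l2_ext => s; rewrite l2_linE !weighted_compE // l2_linE; ring.
by exists 1 => xi; rewrite mul1r; exact: weighted_comp_norm.
Qed.

(** ** Indicator operators and basis vectors *)

Definition ind (P : S -> Prop) (s : S) : R[i] := (`[< P s >])%:R.

Lemma indT P s : P s -> ind P s = 1.
Proof. by move=> Ps; rewrite /ind asboolT. Qed.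

Lemma indF P s : ~ P s -> ind P s = 0.
Proof. by move=> Ps; rewrite /ind asboolF. Qed.

Lemma ind_contractive P : contractive_comp (ind P) id.
Proof.
split=> [s|? ? //]; rewrite /ind.
by case: asboolP => _; rewrite ?sqmod1 ?sqmod0.
Qed.

Definition restrict (P : S -> Prop) : l2S -> l2S := weighted_comp (ind P) id.

Lemma restrictE P xi s : restrict P xi s = ind P s * xi s.
Proof. by rewrite /restrict weighted_compE //; exact: ind_contractive. Qed.

Lemma restrict_bounded P : bounded_operator (restrict P).
Proof. by apply: weighted_comp_bounded; exact: ind_contractive. Qed.

Lemma restrict_norm P xi : l2norm (restrict P xi) <= l2norm xi.
Proof. by apply: weighted_comp_norm; exact: ind_contractive. Qed.

Lemma sqnorm_delta h : sqnorm (ind (eq h)) = 1%E.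
Proof.
rewrite sqnormE (eq_esum (b := fun s => if s \in [set h] then 1%E else 0%E)).
  by rewrite -esum_mkcond esum_set1.
move=> s _; rewrite /ind; case: asboolP => [<-|hs]; first by rewrite mem_set // sqmod1.
by rewrite sqmod0 memNset // => /esym.
Qed.

Definition delta h : l2S := to_l2 (ind (eq h)).

Lemma deltaE h s : delta h s = ind (eq h) s.
Proof.
rewrite /delta /to_l2 -lock -[LHS]/(val _ _) insubdK //.
by apply/mem_set; rewrite /= sqnorm_delta ltry.
Qed.

Lemma delta1 h : delta h h = 1.
Proof. by rewrite deltaE indT. Qed.

Lemma delta0 h s : h <> s -> delta h s = 0.
Proof. by move=> ?; rewrite deltaE indF. Qed.

Lemma l2norm_delta h : l2norm (delta h) = 1.
Proof.
rewrite /l2norm (_ : sqnorm _ = 1%E) ?sqrtr1 // -(sqnorm_delta h); congr sqnorm.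
by apply/funext => s; exact: deltaE.
Qed.

Lemma restrict_delta P h : P h -> restrict P (delta h) = delta h.
Proof.
move=> Ph; apply: l2_ext => s; rewrite restrictE deltaE.
have [<-|hs] := pselect (h = s); first by rewrite indT ?mul1r.
by rewrite (@indF (eq h)) ?mulr0.
Qed.

(** ** Bounded operators *)

Lemma bounded_linear T : bounded_operator T ->
  forall a xi eta, T (a *: xi + eta) = a *: T xi + T eta.
Proof. by case. Qed.

Lemma bounded0 T : bounded_operator T -> T 0 = 0.
Proof.
move=> bT; have := bounded_linear bT (-1) 0 0.
by rewrite !scaleN1r !addNr.
Qed.

Lemma boundedZ T a xi : bounded_operator T -> T (a *: xi) = a *: T xi.
Proof.
by move=> bT; have := bounded_linear bT a xi 0; rewrite (bounded0 bT) !addr0.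
Qed.

Lemma boundedB T xi eta : bounded_operator T -> T (xi - eta) = T xi - T eta.
Proof.
move=> bT; rewrite addrC -scaleN1r (bounded_linear bT) scaleN1r addrC //.
Qed.

Lemma bounded_ge0 T : bounded_operator T ->
  exists2 M : R, 0 < M & forall xi, l2norm (T xi) <= M * l2norm xi.
Proof.
move=> [_ [M h]]; exists (`|M| + 1); first by rewrite ltr_pwDr.
move=> xi; apply: le_trans (h xi) _; rewrite ler_wpM2r ?l2norm_ge0 //.
by rewrite (le_trans (ler_norm M)) // lerDl.
Qed.

Lemma bounded_comp T T' : bounded_operator T -> bounded_operator T' ->
  bounded_operator (T \o T').
Proof.
move=> bT bT'; split=> [a xi eta|].
  by rewrite /= (bounded_linear bT') (bounded_linear bT).
have [M M0 hM] := bounded_ge0 bT; have [M' M'0 hM'] := bounded_ge0 bT'.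
exists (M * M') => xi /=; apply: le_trans (hM _) _.
by rewrite -mulrA ler_wpM2l ?(ltW M0).
Qed.

Lemma bounded_lin a T T' : bounded_operator T -> bounded_operator T' ->
  bounded_operator (a *: T + T').
Proof.
move=> bT bT'; split=> [b xi eta|].
  apply: l2_ext => s.
  rewrite -[LHS]/((a *: T (b *: xi + eta) + T' (b *: xi + eta)) s).
  rewrite (bounded_linear bT) (bounded_linear bT').
  rewrite -[RHS]/(b * (a *: T xi + T' xi) s + (a *: T eta + T' eta) s).
  by rewrite !l2_linE; ring.
have [M M0 hM] := bounded_ge0 bT; have [M' M'0 hM'] := bounded_ge0 bT'.
exists (2 * (Num.sqrt (sqmod a) * M + M')) => xi.
apply: le_trans (l2norm_lin a (T xi) (T' xi)) _.
rewrite -mulrA ler_wpM2l // mulrDl lerD // -mulrA ler_wpM2l ?sqrtr_ge0 //.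
Qed.

Lemma restrict_seq T xi g (s : seq S) : bounded_operator T ->
  (forall h, xi h != 0 -> T (delta h) g = 0) ->
  T xi g = T (restrict (fun h => h \notin s) xi) g.
Proof.
move=> bT hT; elim: s => [|h s IH].
  by congr (T _ _); apply: l2_ext => k; rewrite restrictE indT ?mul1r.
rewrite IH; have [hs|hs] := boolP (h \in s).
  congr (T _ _); apply: l2_ext => k; rewrite !restrictE /ind in_cons negb_or.
  by case: (eqVneq k h) => // ->; rewrite hs.
have -> : restrict (fun k => k \notin s) xi =
    xi h *: delta h + restrict (fun k => k \notin h :: s) xi.
  apply: l2_ext => k; rewrite [RHS]l2_linE [LHS]restrictE [X in _ + X]restrictE.
  rewrite /ind in_cons negb_or.
  have [->|kh] := eqVneq k h.
    by rewrite delta1 hs asboolT // asboolF // mul1r mul0r addr0 mulr1.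
  by rewrite delta0 ?mulr0 ?add0r // => e; rewrite e eqxx in kh.
rewrite (bounded_linear bT) l2_linE.
have [->|/hT ->] := eqVneq (xi h) 0; first by rewrite mul0r add0r.
by rewrite mulr0 add0r.
Qed.

(** Vectors of finite support are dense, and evaluation at a point is
    continuous. *)
Lemma bounded_eval0 T xi g : bounded_operator T ->
  (forall h, xi h != 0 -> T (delta h) g = 0) -> T xi g = 0.
Proof.
move=> bT hT; have [M M0 hM] := bounded_ge0 bT.
apply/eqP; rewrite -normr_le0; apply/ler_addgt0Pr => e e0; rewrite add0r.
have e1 : 0 < complex.Re e by move: e0; case: (e) => u v; rewrite ltcE => /andP[].
have -> : e = (complex.Re e)%:C.
  by move: e0; case: (e) => u v; rewrite ltcE /= => /andP[/eqP -> _].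
move: (complex.Re e) e1 => {e0}e e0.
have [F Ff Fe] : exists2 F : set S, finite_set F &
    ((l2norm xi ^+ 2)%:E < \sum_(s \in F) (sqmod (xi s))%:E + ((e / M) ^+ 2)%:E)%E.
  have lt : (sqnorm xi - ((e / M) ^+ 2)%:E < sqnorm xi)%E.
    by rewrite sqnorm_l2 -EFinB lte_fin ltrBlDr ltrDl exprn_gt0 ?divr_gt0.
  have /ereal_sup_gt [_ [F [Ff _] <-] h] := lt.
  by exists F => //; rewrite -lteBlDr // -sqnorm_l2.
have FS : F = [set` fset_set F] by rewrite fset_setK.
rewrite (@restrict_seq _ _ _ (fset_set F)) //.
apply: le_trans (norm_eval_le _ _) _; rewrite lecR.
apply: le_trans (hM _) _; rewrite -ler_pdivlMl // mulrC.
apply: l2norm_le; first by rewrite divr_ge0 // ltW.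
have -> : sqnorm (restrict (fun h => h \notin fset_set F) xi) =
    (\esum_(s in ~` F) (sqmod (xi s))%:E)%R.
  rewrite sqnormE [RHS]esum_mkcond; apply: eq_esum => s _.
  rewrite restrictE sqmodM.
  have [sF|sF] := pselect (F s).
    rewrite indF ?sqmod0 ?mul0r; last by rewrite in_fset_set // mem_set.
    by rewrite memNset //= => /(_ sF).
  rewrite indT ?sqmod1 ?mul1r; last by rewrite in_fset_set // memNset.
  by rewrite mem_set.
move: Fe; rewrite -sqnorm_l2 sqnormE (esumID F) //; last first.
  by move=> s _; rewrite lee_fin sqmod_ge0.
rewrite !setTI esum_fset //; last by move=> s _; rewrite lee_fin sqmod_ge0.
rewrite lteD2lE; first exact: ltW.
rewrite fsbig_finite //= sumEFin //.
Qed.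

(** ** Norm closures *)

Lemma norm_closure_sub (D : set (l2S -> l2S)) T :
  bounded_operator T -> D T -> norm_closure D T.
Proof.
move=> bT DT; split=> // e e0; exists T => // xi.
rewrite subrr (_ : l2norm 0 = 0) ?mulr_ge0 ?l2norm_ge0 ?(ltW e0) //.
by rewrite /l2norm /sqnorm esum1 ?sqrtr0 // => s _ /=; rewrite expr0n addr0.
Qed.

Lemma norm_closureS (D E : set (l2S -> l2S)) :
  D `<=` E -> norm_closure D `<=` norm_closure E.
Proof.
move=> DE T [bT h]; split=> // e e0.
by have [T' /DE ET' hT'] := h e e0; exists T'.
Qed.

Lemma norm_closureK (D : set (l2S -> l2S)) :
  norm_closure (norm_closure D) `<=` norm_closure D.
Proof.
move=> T [bT h]; split=> // e e0.
have e4 : 0 < e / 4 by rewrite divr_gt0.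
have [T1 [_ h1] hT1] := h _ e4; have [T2 DT2 hT2] := h1 _ e4.
exists T2 => // xi.
have -> : T xi - T2 xi = (T xi - T1 xi) + (T1 xi - T2 xi) by rewrite addrA subrK.
apply: le_trans (l2norm_add _ _) _.
have := hT1 xi; have := hT2 xi; lra.
Qed.

Lemma norm_closure_compl (D E : set (l2S -> l2S)) T : bounded_operator T ->
  (forall T', D T' -> norm_closure E (T \o T')) ->
  forall T', norm_closure D T' -> norm_closure E (T \o T').
Proof.
move=> bT hD T' [bT' hT']; apply: norm_closureK; split; first exact: bounded_comp.
move=> e e0; have [M M0 hM] := bounded_ge0 bT.
have [T1 DT1 hT1] := hT' (e / M) (divr_gt0 e0 M0).
exists (T \o T1); first exact: hD.
move=> xi /=; rewrite -(boundedB _ _ bT); apply: le_trans (hM _) _.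
apply: (@le_trans _ _ (M * (e / M * l2norm xi))); first by rewrite ler_wpM2l ?(ltW M0).
by rewrite mulrA [M * _]mulrC divfK ?lt0r_neq0.
Qed.

Lemma norm_closure_compr (D E : set (l2S -> l2S)) T : bounded_operator T ->
  (forall T', D T' -> norm_closure E (T' \o T)) ->
  forall T', norm_closure D T' -> norm_closure E (T' \o T).
Proof.
move=> bT hD T' [bT' hT']; apply: norm_closureK; split; first exact: bounded_comp.
move=> e e0; have [M M0 hM] := bounded_ge0 bT.
have [T1 DT1 hT1] := hT' (e / M) (divr_gt0 e0 M0).
exists (T1 \o T); first exact: hD.
move=> xi /=; apply: le_trans (hT1 _) _.
apply: (@le_trans _ _ (e / M * (M * l2norm xi))).
  by rewrite ler_wpM2l // divr_ge0 // ltW.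
by rewrite mulrA divfK ?lt0r_neq0.
Qed.

Lemma norm_closure_comm (D : set (l2S -> l2S)) T : bounded_operator T ->
  (forall T', D T' -> T \o T' = T' \o T) ->
  forall T', norm_closure D T' -> T \o T' = T' \o T.
Proof.
move=> bT hD T' [bT' hT']; apply/funext => xi /=; apply/eqP; rewrite -subr_eq0.
apply/eqP/l2norm_eq0/eqP; rewrite eq_le l2norm_ge0 andbT; apply/ler_addgt0Pr => e e0.
rewrite add0r; have [M M0 hM] := bounded_ge0 bT.
pose C := 2 * (M * l2norm xi + M * l2norm xi) + 1.
have C0 : 0 < C.
  by rewrite ltr_wpDl // mulr_ge0 // addr_ge0 // mulr_ge0 ?l2norm_ge0 // ltW.
have [T1 DT1 hT1] := hT' (e / C) (divr_gt0 e0 C0).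
have -> : T (T' xi) - T' (T xi) = T (T' xi - T1 xi) + - (T' (T xi) - T1 (T xi)).
  rewrite (boundedB _ _ bT) -[T (T1 xi)]/((T \o T1) xi) (hD _ DT1) /=.
  by rewrite opprB addrA addrNK.
apply: le_trans (l2norm_add _ _) _; rewrite l2normN.
have h1 : l2norm (T (T' xi - T1 xi)) <= e / C * (M * l2norm xi).
  apply: le_trans (hM _) _; rewrite mulrCA ler_wpM2l ?(ltW M0) //.
have h2 : l2norm (T' (T xi) - T1 (T xi)) <= e / C * (M * l2norm xi).
  apply: le_trans (hT1 _) _; rewrite ler_wpM2l // divr_ge0 // ltW //.
apply: (@le_trans _ _ (e / C * C)); last by rewrite divfK // lt0r_neq0.
have q0 : 0 <= e / C by rewrite divr_ge0 // ltW.
move: h1 h2 q0; rewrite {5}/C; move: (e / C) (M * l2norm xi) => q N h1 h2 q0.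
have -> : q * (2 * (N + N) + 1) = 2 * (q * N + q * N) + q by ring.
lra.
Qed.

End SquareSummable.

Arguments ind R {S} P s.
Arguments restrict R {S} P.
Arguments delta R {S} h.

(** * The algebras of the groupoid *)

Section Algebras.
Variables (R : realType) (A : finType) (X : shift_space A).
Local Notation G := (groupoid X).
Local Notation l2G := (l2 R G).
Local Notation pi := (@factor_map A X).
Implicit Types (g h k : G) (x y : cover X) (U V : set (cover X)) (xi eta : l2G).
Implicit Types (S T : l2G -> l2G).

Lemma continuous_near (Z : topologicalType) (f : Z -> R[i]) :
  (forall z : Z, exists2 f' : Z -> R[i],
     continuous f' & \forall w \near z, f w = f' w) ->
  continuous f.
Proof.
move=> hf x; have [f' cf' e] := hf x.
suff : f @ x --> f' x by rewrite /continuous_at (nbhs_singleton e).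
apply: cvg_trans (cf' x).
by apply: near_eq_cvg; apply: filterS e => y /= ->.
Qed.

Lemma continuous_ind (Z : topologicalType) (P : set Z) :
  (forall z, P z -> nbhs z P) -> (forall z, ~ P z -> nbhs z (~` P)) ->
  continuous (ind R P).
Proof.
move=> oP oP'; apply: continuous_near => x.
have [Px|Px] := pselect (P x).
  exists (fun=> 1); first exact: cst_continuous.
  by apply: filterS (oP x Px) => y /= Py; rewrite indT.
exists (fun=> 0); first exact: cst_continuous.
by apply: filterS (oP' x Px) => y /= Py; rewrite indF.
Qed.

Lemma continuous_mul_ind (Z : topologicalType) (P : set Z) (f : Z -> R[i]) :
  (forall z, P z -> nbhs z P) -> (forall z, ~ P z -> nbhs z (~` P)) ->
  continuous f -> continuous (fun z => ind R P z * f z).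
Proof.
move=> oP oP' cf; apply: continuous_near => x.
have [Px|Px] := pselect (P x).
  by exists f => //; apply: filterS (oP x Px) => y /= Py; rewrite indT // mul1r.
exists (fun=> 0); first exact: cst_continuous.
by apply: filterS (oP' x Px) => y /= Py; rewrite indF // mul0r.
Qed.

Lemma eq_small (a b : R[i]) :
  (forall e : R, 0 < e -> `|a - b| <= e%:C) -> a = b.
Proof.
move=> h; apply/eqP; rewrite -subr_eq0 -normr_le0 normE.
have h' : Num.sqrt (sqmod (a - b)) <= 0.
  apply/ler_addgt0Pr => e e0; rewrite add0r.
  by have := h e e0; rewrite normE lecR.
by rewrite lecR.
Qed.

(** ** Convolution *)

Lemma convolution1 (f : G -> R[i]) (eta : G -> R[i]) k h g : is_product k h g ->
  (forall k' h', is_product k' h' g -> (k', h') <> (k, h) -> f k' * eta h' = 0) ->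
  convolution f eta g = f k * eta h.
Proof.
move=> kh h0; rewrite /convolution -(fsbig_widen [set (k, h)]).
- by rewrite fsbig_set1.
- by move=> _ ->.
- by move=> [k' h'] /= [p /eqP ne]; apply: h0 => //; apply/eqP.
Qed.

Lemma convolution_delta (f : G -> R[i]) k h g : is_product k h g ->
  convolution f (delta R h) g = f k.
Proof.
move=> p; rewrite (convolution1 p) ?delta1 ?mulr1 // => k' h' p' ne.
rewrite delta0 ?mulr0 // => e; apply: ne; rewrite -e in p' *.
by rewrite (product_uniql p p').
Qed.

Lemma convolution_delta0 (f : G -> R[i]) h g : source_of g <> source_of h ->
  convolution f (delta R h) g = 0.
Proof.
move=> gh; rewrite /convolution fsbig1 // => -[k' h'] [/= _ _ e _].
by rewrite delta0 ?mulr0 // => e'; apply: gh; rewrite e'.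
Qed.

Lemma convolution_unit (f : cover X -> R[i]) xi g :
  convolution (unit_extension f) xi g = f (range_of g) * xi g.
Proof.
rewrite (convolution1 (unit_at_range g)) /unit_extension; last first.
  move=> k h p ne; case: asboolP => [uk|_]; last by rewrite mul0r.
  exfalso; apply: ne; have e : k = unit_at (range_of g).
    by rewrite (is_unitE uk); have [_ -> _ _] := p.
  by rewrite e in p *; rewrite (product_uniqr p (unit_at_range g)).
by rewrite asboolT.
Qed.

(** ** Matrix coefficients of elements of the algebra *)

Definition Cc_operators : set (l2G -> l2G) := [set T | exists f : G -> R[i],
  [/\ continuous f, compactly_supported f & represents f T]].

Lemma OX_bounded S : OX R X S -> bounded_operator S.
Proof. by case. Qed.

Lemma norm_coefficient_le S T (e : R) :
  (forall xi, l2norm (S xi - T xi) <= e * l2norm xi) ->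
  forall h g, `|S (delta R h) g - T (delta R h) g| <= e%:C.
Proof.
move=> hST h g; have := norm_eval_le (S (delta R h) - T (delta R h)) g.
by move=> /le_trans; apply; rewrite lecR -[e]mulr1 -(l2norm_delta R h).
Qed.

Lemma OX_approx S (e : R) : OX R X S -> 0 < e -> exists f : G -> R[i],
  continuous f /\ forall h g, `|S (delta R h) g - convolution f (delta R h) g| <= e%:C.
Proof.
move=> [_ hS] e0; have [T [f [cf _ [_ rf]]] hT] := hS e e0.
by exists f; split=> // h g; rewrite -rf; exact: norm_coefficient_le.
Qed.

Lemma OX_coefficient0 S h g : OX R X S -> source_of g <> source_of h ->
  S (delta R h) g = 0.
Proof.
move=> OS gh; apply: eq_small => e e0; have [f [_ hf]] := OX_approx OS e0.
by have := hf h g; rewrite convolution_delta0.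
Qed.

(** The function on the groupoid by which S acts through convolution. *)
Definition symbol S g : R[i] := S (delta R (unit_at (source_of g))) g.

(** Convolution operators are invariant under right translation, and so are their
    limits. *)
Lemma OX_coefficient S k h g : OX R X S -> is_product k h g ->
  S (delta R h) g = symbol S k.
Proof.
move=> OS p; apply: eq_small => e e0.
have e2 : 0 < e / 2 by rewrite divr_gt0.
have [f [_ hf]] := OX_approx OS e2.
have := hf h g; rewrite (convolution_delta f p).
have := hf (unit_at (source_of k)) k; rewrite (convolution_delta f (product_unit_at k)).
rewrite /symbol distrC => h1 h2; apply: le_trans (ler_distD (f k) _ _) _.
by rewrite [e](splitr e) rmorphD /=; apply: lerD.
Qed.

Lemma symbol_continuous S : OX R X S -> continuous (symbol S).
Proof.
move=> OS g; apply/(@cvgrPdist_le _ _ _ _ (nbhs_filter g)) => e e0.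
have e1 : e = (complex.Re e)%:C.
  by move: e0; case: (e) => u v; rewrite ltcE /= => /andP[/eqP -> _].
rewrite e1 in e0 *; rewrite ltcR in e0; move: (complex.Re e) e0 => {e1}e e0.
have e3 : 0 < e / 3 by rewrite divr_gt0.
have [f [cf hf]] := OX_approx OS e3.
have hfg h : `|symbol S h - f h| <= (e / 3)%:C.
  have := hf (unit_at (source_of h)) h.
  by rewrite (convolution_delta f (product_unit_at h)).
have e3C : (0 : R[i]) < (e / 3)%:C by rewrite ltcR.
have /(@cvgrPdist_le _ _ _ _ (nbhs_filter g)) /(_ _ e3C) hg := cf g.
apply: (@filterS _ (nbhs g) _ _ _ _ hg) => h hh.
have -> : e = e / 3 + e / 3 + e / 3 by field.
rewrite !rmorphD /=; apply: le_trans (ler_distD (f h) _ _) _.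
apply: lerD; last by rewrite distrC.
by apply: le_trans (ler_distD (f g) _ _) _; apply: lerD.
Qed.

Lemma OX_eq0 S : OX R X S -> (forall g, symbol S g = 0) -> S = 0.
Proof.
move=> OS S0; apply: op_ext => xi g; apply: bounded_eval0; first exact: OX_bounded.
move=> h _; have [gh|/OX_coefficient0 -> //] := pselect (source_of g = source_of h).
by have [k p] := right_quotient_ex gh; rewrite (OX_coefficient OS p).
Qed.

(** ** The diagonal subalgebras *)

Lemma DXP T : DX R X T <-> bounded_operator T /\ exists2 f : cover X -> R[i],
  continuous f & forall xi g, T xi g = f (range_of g) * xi g.
Proof.
split=> [[f cf [bT rT]]|[bT [f cf hf]]].
  by split=> //; exists f => // xi g; rewrite rT convolution_unit.
by exists f => //; split=> // xi g; rewrite convolution_unit.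
Qed.

Lemma DX_comm T T' : DX R X T -> DX R X T' -> T \o T' = T' \o T.
Proof.
move=> /DXP [_ [f _ hf]] /DXP [_ [f' _ hf']]; apply: op_ext => xi g /=.
by rewrite hf hf' hf' hf mulrCA.
Qed.

Lemma CX_sub_DX : CX R X `<=` DX R X.
Proof.
move=> T [f cf rT]; exists (f \o pi) => //.
move=> t; apply: (@continuous_comp _ (subspace (points X)) _ pi f); last exact: cf.
move=> B hB; have {hB} : within (points X) (nbhs (pi t)) B.
  by rewrite nbhs_subspace_in //; exact: factor_map_points.
rewrite (@withinE _ _ _ (nbhs_filter (pi t))) => -[V nV e].
have hV := @factor_map_continuous A X t V nV.
apply: (@filterS _ (nbhs t) _ _ _ _ hV) => s Vs; have : (V `&` points X) (pi s).
  by split=> //; exact: factor_map_points.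
by rewrite -e => -[].
Qed.

Lemma DX_sub_OX : DX R X `<=` OX R X.
Proof.
move=> T [f cf [bT rT]]; apply: norm_closure_sub => //; exists (unit_extension f).
split=> //; last first.
  exists (range (@unit_at _ X)); first exact: compact_units.
  move=> g ng; rewrite /unit_extension asboolF // => /is_unitE e; apply: ng.
  by rewrite e; exists (range_of g).
apply: continuous_near => g; have [ug|ug] := pselect (is_unit g).
  exists (f \o @range_of A X).
    by move=> h; apply: continuous_comp; [exact: range_of_continuous|exact: cf].
  by apply: filterS (unit_nbhs ug) => h uh; rewrite /unit_extension asboolT.
exists (fun=> 0); first exact: cst_continuous.
by apply: filterS (nonunit_nbhs ug) => h uh; rewrite /unit_extension asboolF.
Qed.

(** For clopen U this is the projection 1_U in D_X. *)
Definition chi U : l2G -> l2G := restrict R (fun g => U (range_of g)).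

Definition is_clopen U := open U /\ open (~` U).

Lemma chiE U xi g : chi U xi g = ind R U (range_of g) * xi g.
Proof. by rewrite /chi restrictE. Qed.

Lemma chi_bounded U : bounded_operator (chi U).
Proof. exact: restrict_bounded. Qed.

Lemma chi_norm U xi : l2norm (chi U xi) <= l2norm xi.
Proof. exact: restrict_norm. Qed.

Lemma scale_chi_DX (c : R[i]) U : is_clopen U -> DX R X (c *: chi U).
Proof.
move=> cU; apply/DXP; split.
  have := bounded_lin c (chi_bounded U) (chi_bounded set0).
  suff -> : c *: chi U + chi set0 = c *: chi U by [].
  apply: op_ext => xi g; rewrite -[LHS]/((c *: chi U xi + chi set0 xi) g) l2_linE.
  by rewrite [chi set0 _ _]chiE indF ?mul0r ?addr0.
exists (fun x => ind R U x * c) => [|xi g]; last first.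
  by rewrite -[LHS]/(c * chi U xi g) chiE mulrA [c * _]mulrC.
have [oU oU'] := cU; apply: (@continuous_mul_ind _ U (fun=> c)) => [x Ux|x Ux|].
- exact: open_nbhs_nbhs.
- exact: open_nbhs_nbhs.
- exact: cst_continuous.
Qed.

Lemma chi_DX U : is_clopen U -> DX R X (chi U).
Proof. by move=> /(scale_chi_DX 1); rewrite scale1r. Qed.

Lemma scale_chi_OX c U : is_clopen U -> OX R X (c *: chi U).
Proof. by move=> cU; apply/DX_sub_OX/scale_chi_DX. Qed.

Lemma chi_OX U : is_clopen U -> OX R X (chi U).
Proof. by move=> cU; apply/DX_sub_OX/chi_DX. Qed.

Lemma chiI U V : chi U \o chi V = chi (U `&` V).
Proof.
apply: op_ext => xi g /=; rewrite !chiE mulrA; congr (_ * _).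
rewrite /ind asbool_and; case: asboolP => _; case: asboolP => _ //=;
  by rewrite ?mulr1 ?mulr0 ?mul0r.
Qed.

Lemma is_clopenI U V : is_clopen U -> is_clopen V -> is_clopen (U `&` V).
Proof.
move=> [oU cU] [oV cV]; split; first exact: openI.
by rewrite setCI; exact: openU.
Qed.

Lemma is_clopen_isolated x : nbhs x [set x] -> is_clopen [set x].
Proof.
move=> nx; split; first by rewrite openE => _ ->.
rewrite openE => y /= yx; have [U [oU _ Uy nUx]] := cover_separated yx.
by rewrite /interior nbhsE; exists U => // z Uz /= zx; apply: nUx; rewrite -zx.
Qed.

Definition cylinder_above (n : nat) (a : A) : set (cover X) := [set t | pi t n = a].

Lemma cylinder_above_clopen n a : is_clopen (cylinder_above n a).
Proof.
split; first exact: (@open_factor_map A X n (fun b => b = a)).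
exact: (@open_factor_map A X n (fun b => b <> a)).
Qed.

Lemma chi_symbol_CX n a : CX R X (chi (cylinder_above n a)).
Proof.
exists (ind R [set z : full_shift A | z n = a]); last first.
  split; first exact: chi_bounded.
  by move=> xi g; rewrite convolution_unit chiE.
apply: continuous_subspaceT.
have cn (P : A -> Prop) (z : full_shift A) :
    P (z n) -> nbhs z [set w : full_shift A | P (w n)].
  move=> Pz; have := @proj_continuous nat (fun=> discrete_topology A) n z.
  move=> /(_ _ (discrete_set1 (z n))); apply: (@filterS _ (nbhs z)) => w /= e.
  by rewrite /proj in e; rewrite e.
apply: continuous_ind => z; first exact: (cn (fun b => b = a)).
exact: (cn (fun b => b <> a)).
Qed.

Lemma source_of_nbhs U g :
  open U -> U (source_of g) -> nbhs g (@source_of A X @^-1` U).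
Proof.
by move=> oU Ug; exact: (source_of_continuous (open_nbhs_nbhs (conj oU Ug))).
Qed.

Lemma range_of_nbhs U g :
  open U -> U (range_of g) -> nbhs g (@range_of A X @^-1` U).
Proof.
by move=> oU Ug; exact: (range_of_continuous (open_nbhs_nbhs (conj oU Ug))).
Qed.

(** ** Compressing by clopen sets *)

Lemma OX_comp_chi S U : is_clopen U -> OX R X S -> OX R X (S \o chi U).
Proof.
move=> [oU cU] [bS hS]; split; first exact: bounded_comp bS (chi_bounded U).
move=> e e0; have [T [f [cf [K cK fK] [bT rT]]] hT] := hS e e0.
exists (T \o chi U); last first.
  move=> xi; apply: le_trans (hT _) _.
  by rewrite ler_wpM2l ?(ltW e0) // chi_norm.
exists (fun g => ind R (@source_of A X @^-1` U) g * f g); split.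
- apply: continuous_mul_ind cf => g Ug; first exact: source_of_nbhs oU Ug.
  exact: source_of_nbhs cU Ug.
- by exists K => // g /fK ->; rewrite mulr0.
split; first exact: bounded_comp bT (chi_bounded U).
move=> xi g /=; rewrite rT /convolution.
apply: eq_fsbigr => -[k h] /set_mem [/= kh _ _ _].
by rewrite chiE -kh mulrCA mulrA.
Qed.

Lemma OX_chi_comp S U : is_clopen U -> OX R X S -> OX R X (chi U \o S).
Proof.
move=> [oU cU] [bS hS]; split; first exact: bounded_comp (chi_bounded U) bS.
move=> e e0; have [T [f [cf [K cK fK] [bT rT]]] hT] := hS e e0.
exists (chi U \o T); last first.
  move=> xi; apply: le_trans _ (hT _) => /=.
  by rewrite -(boundedB _ _ (chi_bounded U)) chi_norm.
exists (fun g => ind R (@range_of A X @^-1` U) g * f g); split.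
- apply: continuous_mul_ind cf => g Ug; first exact: range_of_nbhs oU Ug.
  exact: range_of_nbhs cU Ug.
- by exists K => // g /fK ->; rewrite mulr0.
split; first exact: bounded_comp (chi_bounded U) bT.
move=> xi g /=; rewrite chiE rT /convolution.
have [Ug|Ug] := pselect (U (range_of g)).
  rewrite indT // mul1r; apply: eq_fsbigr => -[k h] /set_mem [/= _ kg _ _].
  by rewrite indT ?mul1r //= -kg.
rewrite indF // mul0r fsbig1 // => -[k h] [/= _ kg _ _].
by rewrite indF ?mul0r //= -kg.
Qed.

(** ** The relative commutant of C(X) *)

(** The matrix coefficient of S at (g, h) is the value of the symbol at the
    quotient of g and h, a unit only for g = h; so S multiplies by the restriction
    of its symbol to the units. *)
Lemma diagonal_DX S : OX R X S -> (forall g, symbol S g != 0 -> is_unit g) -> DX R X S.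
Proof.
move=> OS hS; apply/DXP; split; first exact: OX_bounded.
exists (fun x => symbol S (unit_at x)).
  move=> x; apply: continuous_comp; first exact: unit_at_continuous.
  exact: symbol_continuous.
move=> xi g; have bS := OX_bounded OS.
have -> : xi = xi g *: delta R g + restrict R (fun h => h <> g) xi.
  apply: l2_ext => h; rewrite [RHS]l2_linE [restrict _ _ _ _]restrictE.
  have [->|hg] := pselect (h = g).
    by rewrite delta1 indF ?mul0r ?addr0 ?mulr1 //; apply.
  by rewrite delta0 ?indT ?mulr0 ?add0r ?mul1r //; exact: nesym.
rewrite (bounded_linear bS) !l2_linE (OX_coefficient OS (unit_at_range g)).
rewrite delta1 [restrict _ _ _ _]restrictE indF ?mul0r ?addr0 ?mulr1; last by apply.
rewrite bounded_eval0 ?addr0 //; first by rewrite mulrC.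
move=> h; rewrite restrictE.
have [->|hg] := pselect (h = g); first by rewrite indF ?mul0r ?eqxx //; apply.
move=> _; have [gh|/OX_coefficient0 -> //] := pselect (source_of g = source_of h).
have [k p] := right_quotient_ex gh; rewrite (OX_coefficient OS p).
apply/eqP; apply: contraT => /hS uk; exfalso; apply: hg.
have e := is_unitE uk; have [p1 p2 p3 p4] := p.
by apply: groupoid_eq => //; rewrite ?p3 ?p2 ?p4 -?p1 ?(proj1 uk) ?add0r ?(proj2 uk).
Qed.

Definition commutes_CX S :=
  forall n a, S \o chi (cylinder_above n a) = chi (cylinder_above n a) \o S.

(** Commuting with the projections onto cylinders forces the symbol to vanish
    where the factor map separates range and source.  The symbol is continuous, so
    around an element of its support the factor map identifies the two, and
    [fibre_preserving] applies. *)
Lemma commutant_symbol S g : OX R X S -> commutes_CX S -> symbol S g != 0 ->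
  is_unit g \/ range_of g = source_of g /\ nbhs (range_of g) [set range_of g].
Proof.
move=> OS cS Sg; apply: fibre_preserving.
have : nbhs g [set h | symbol S h != 0].
  exact: (@cvgr_neq0 _ _ _ _ (nbhs_filter g) _ _ (symbol_continuous OS (x := g)) Sg).
apply: filterS => h /= Sh; apply/funext => n.
apply: contrapT => ne; move/eqP: Sh; apply.
have := congr1 (fun T : l2G -> l2G => T (delta R (unit_at (source_of h))) h)
  (cS n (pi (source_of h) n)).
by rewrite /= {1}/chi restrict_delta // chiE indF ?mul0r.
Qed.

(** Range and source agree on the support of the symbol, by [commutant_symbol]. *)
Lemma commutant_chi S U : OX R X S -> commutes_CX S -> S \o chi U = chi U \o S.
Proof.
move=> OS cS; have bS := OX_bounded OS; apply: op_ext => xi g /=; rewrite chiE.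
suff : S (chi U xi - ind R U (range_of g) *: xi) g = 0.
  rewrite (boundedB _ _ bS) l2_subE (boundedZ _ _ bS).
  by move=> /eqP; rewrite subr_eq0 => /eqP.
apply: bounded_eval0 => // h; rewrite l2_subE chiE -[(_ *: xi) h]/(_ * xi h) -mulrBl.
have [->|rgh] := pselect (range_of h = range_of g).
  by rewrite subrr mul0r eqxx.
move=> _; have [gh|/OX_coefficient0 -> //] := pselect (source_of g = source_of h).
have [k p] := right_quotient_ex gh; rewrite (OX_coefficient OS p).
apply/eqP; apply: contraT => /(commutant_symbol OS cS) hk; exfalso; apply: rgh.
have [p1 p2 p3 p4] := p; rewrite p2 -p1.
by case: hk => [[_ ->]|[-> _]].
Qed.

End Algebras.

Arguments chi R {A X} U.
Arguments cylinder_above {A X} n a.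

(** * Isolated points of the cover *)

Section Corner.
Variables (R : realType) (A : finType) (X : shift_space A).
Local Notation G := (groupoid X).
Local Notation l2G := (l2 R G).
Variable x : cover X.
Hypothesis x_isolated : nbhs x [set x].
Implicit Types (g h k : G) (xi eta : l2G) (S T : l2G -> l2G) (a : R[i]).

Definition isotropy k := range_of k = x /\ source_of k = x.

Lemma isotropy_eq k k' : isotropy k -> isotropy k' -> degree k = degree k' -> k = k'.
Proof. by move=> [a1 a2] [b1 b2] e; apply: groupoid_eq => //; congruence. Qed.

(** The element k^-1 g, and g itself when k and g have different ranges. *)
Definition left_div k g : G := xget g [set h | is_product k h g].

Lemma left_divP k g : range_of g = range_of k -> is_product k (left_div k g) g.
Proof. by move=> /left_quotient_ex; exact: xgetPex. Qed.

Lemma left_div_eq k h g : is_product k h g -> left_div k g = h.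
Proof.
move=> p; have [_ e _ _] := p.
by apply: (product_uniqr _ p); exact: left_divP.
Qed.

Lemma left_div_range k g : isotropy k -> range_of g = x -> range_of (left_div k g) = x.
Proof. by move=> [k1 k2] gx; have [|<-] := @left_divP k g; rewrite ?gx. Qed.

Definition translation k : l2G -> l2G :=
  weighted_comp (ind R (fun g => range_of g = x)) (left_div k).

Lemma translation_contractive k : isotropy k ->
  contractive_comp (ind R (fun g => range_of g = x)) (left_div k).
Proof.
move=> [k1 k2]; split=> [s|s s']; first exact: (ind_contractive _ _).1.
rewrite !inE /ind; case: asboolP => [sx _|_]; last by rewrite eqxx.
case: asboolP => [s'x _ e|_]; last by rewrite eqxx.
have [|p1 p2 p3 p4] := @left_divP k s; first by rewrite sx.
have [|q1 q2 q3 q4] := @left_divP k s'; first by rewrite s'x.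
by apply: groupoid_eq; rewrite ?sx ?s'x // ?p4 ?q4 ?p3 ?q3 e.
Qed.

Lemma translationE k xi g : isotropy k ->
  translation k xi g = ind R (fun g => range_of g = x) g * xi (left_div k g).
Proof.
move=> ik; rewrite /translation weighted_compE //.
exact: translation_contractive.
Qed.

Lemma translation_bounded k : isotropy k -> bounded_operator (translation k).
Proof. by move=> ik; apply: weighted_comp_bounded; exact: translation_contractive. Qed.

Lemma left_div_comp k k' k'' g : isotropy k -> isotropy k' -> isotropy k'' ->
  degree k'' = degree k + degree k' -> range_of g = x ->
  left_div k' (left_div k g) = left_div k'' g.
Proof.
move=> ik ik' ik'' dk gx; apply/esym/left_div_eq.
have [|p1 p2 p3 p4] := @left_divP k g; first by rewrite gx (proj1 ik).
have [|q1 q2 q3 q4] := @left_divP k' (left_div k g).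
  by rewrite left_div_range // (proj1 ik').
split; rewrite ?(proj2 ik'') ?(proj1 ik'') //.
- by rewrite -q1 (proj2 ik').
- by rewrite p3 q3.
- by rewrite p4 q4 dk addrA.
Qed.

Lemma translation_comp k k' : isotropy k -> isotropy k' ->
  exists k'', [/\ isotropy k'', degree k'' = degree k + degree k' &
    translation k \o translation k' = translation k''].
Proof.
move=> ik ik'; have [|k'' [p1 p2 p3 p4]] := @product_ex _ _ k k'.
  by rewrite (proj2 ik) (proj1 ik').
have ik'' : isotropy k'' by split; rewrite ?p2 ?p3 ?(proj1 ik) ?(proj2 ik').
exists k''; split=> //; apply: op_ext => xi g /=; rewrite !translationE //.
have [gx|gx] := pselect (range_of g = x); last by rewrite indF ?mul0r.
rewrite indT // !mul1r indT ?mul1r ?left_div_range //.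
by rewrite (left_div_comp (k'' := k'')).
Qed.

(** The isotropy group at x is commutative, being embedded in the integers by the
    degree. *)
Lemma translation_comm k k' : isotropy k -> isotropy k' ->
  translation k \o translation k' = translation k' \o translation k.
Proof.
move=> ik ik'; have [l [il dl ->]] := translation_comp ik ik'.
have [l' [il' dl' ->]] := translation_comp ik' ik.
by congr translation; apply: isotropy_eq; rewrite // dl dl' addrC.
Qed.

(** A copy of the group algebra of a subgroup of the integers. *)
Inductive isotropy_span : set (l2G -> l2G) :=
| isotropy_span0 : isotropy_span 0
| isotropy_spanD a k T : isotropy k -> isotropy_span T ->
    isotropy_span (a *: translation k + T).

Lemma op_linE a S T xi g : (a *: S + T) xi g = a * S xi g + T xi g.
Proof. by []. Qed.

Lemma op0E xi g : (0 : l2G -> l2G) xi g = 0.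
Proof. by []. Qed.

Lemma bounded_op0 : bounded_operator (0 : l2G -> l2G).
Proof.
split=> [a xi eta|]; first by apply: l2_ext => g; rewrite l2_linE !op0E mulr0 addr0.
exists 1 => xi; rewrite mul1r; have := restrict_norm (fun=> False) xi.
congr (l2norm _ <= _); apply: l2_ext => g.
by rewrite restrictE indF ?mul0r.
Qed.

Lemma isotropy_span_bounded T : isotropy_span T -> bounded_operator T.
Proof.
elim=> [|a k T' ik _ bT]; first exact: bounded_op0.
by apply: bounded_lin => //; exact: translation_bounded.
Qed.

Lemma isotropy_span_lin a T T' : isotropy_span T -> isotropy_span T' ->
  isotropy_span (a *: T + T').
Proof.
elim=> [|b k T1 ik _ IH] hT'; first by rewrite scaler0 add0r.
rewrite scalerDr scalerA -addrA; apply: isotropy_spanD => //; exact: IH.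
Qed.

Lemma comp_linl a S T T' : (a *: S + T) \o T' = a *: (S \o T') + (T \o T').
Proof. by []. Qed.

Lemma comp_linr a S T T' : bounded_operator T' ->
  T' \o (a *: S + T) = a *: (T' \o S) + (T' \o T).
Proof. by move=> bT'; apply/funext => xi /=; exact: bounded_linear. Qed.

Lemma comp_op0 T : bounded_operator T -> T \o (0 : l2G -> l2G) = 0.
Proof. by move=> bT; apply/funext => xi /=; exact: bounded0. Qed.

Lemma isotropy_span_comp T T' : isotropy_span T -> isotropy_span T' ->
  isotropy_span (T \o T').
Proof.
move=> hT hT'; elim: hT => [|a k T1 ik _ IH]; first exact: isotropy_span0.
rewrite comp_linl; apply: isotropy_span_lin IH.
elim: hT' => [|b k' T2 ik' _ IH'].
  by rewrite comp_op0; [exact: isotropy_span0|exact: translation_bounded].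
rewrite comp_linr; last exact: translation_bounded.
have [k'' [ik'' _ ->]] := translation_comp ik ik'.
exact: isotropy_spanD.
Qed.

Lemma isotropy_span_comm T T' : isotropy_span T -> isotropy_span T' ->
  T \o T' = T' \o T.
Proof.
move=> hT hT'; elim: hT => [|a k T1 ik _ IH].
  by rewrite comp_op0 //; exact: isotropy_span_bounded.
rewrite comp_linl IH comp_linr; last exact: isotropy_span_bounded.
congr (_ *: _ + _); elim: hT' => [|b k' T2 ik' _ IH'].
  by rewrite comp_op0 //; exact: translation_bounded.
rewrite comp_linl -IH' comp_linr; last exact: translation_bounded.
by rewrite translation_comm.
Qed.

Definition isotropy_algebra : set (l2G -> l2G) := norm_closure isotropy_span.

Lemma isotropy_algebra_comp S T : isotropy_algebra S -> isotropy_algebra T ->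
  isotropy_algebra (S \o T).
Proof.
move=> hS hT; apply: (norm_closure_compr (proj1 hT) _ hS) => S' hS'.
apply: (norm_closure_compl (isotropy_span_bounded hS') _ hT) => T' hT'.
have h := isotropy_span_comp hS' hT'.
exact: norm_closure_sub (isotropy_span_bounded h) h.
Qed.

Lemma isotropy_algebra_comm S T : isotropy_algebra S -> isotropy_algebra T ->
  S \o T = T \o S.
Proof.
move=> hS hT; apply: (norm_closure_comm (proj1 hS) _ hT) => T' hT'.
apply/esym; apply: (norm_closure_comm (isotropy_span_bounded hT') _ hS) => S' hS'.
exact: isotropy_span_comm.
Qed.

(** ** Compressions to an isolated point *)

Lemma finite_isotropy (N : nat) :
  finite_set [set k | isotropy k /\ (`|degree k| <= N)%N].
Proof.
pose F n := xget (unit_at x) [set k | isotropy k /\ degree k = n].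
apply: (@sub_finite_set _ _ (F @` ((fun n : 'I_(N + N).+1 => n%:Z - N%:Z) @` setT))).
  move=> k [ik dk]; exists (degree k).
    have h : (`|(degree k + N%:Z)%R|%N < (N + N).+1)%N by lia.
    by exists (Ordinal h) => //=; lia.
  rewrite /F; have [] : [set k' | isotropy k' /\ degree k' = degree k] (F (degree k)).
    by apply: xgetPex; exists k.
  by move=> iF dF; apply: isotropy_eq.
by apply: finite_image; apply: finite_image.
Qed.

(** A compactly supported function takes nonzero values at only finitely many
    isotropy elements at x, because they are separated by their degrees. *)
Lemma compression_span (f : G -> R[i]) T : compactly_supported f -> represents f T ->
  isotropy_span (chi R [set x] \o T \o chi R [set x]).
Proof.
move=> [K cK fK] [_ rT]; have [N hN] := compact_degree cK.
pose D := [set k | isotropy k /\ (`|degree k| <= N)%N].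
have finD : finite_set D by exact: finite_isotropy.
have spanP (s : seq G) : (forall k, k \in s -> isotropy k) ->
    exists2 T', isotropy_span T' & forall xi g,
      T' xi g = \sum_(k <- s) f k * translation k xi g.
  elim: s => [|k s IH] hs.
    by exists 0; [exact: isotropy_span0|move=> xi g; rewrite big_nil].
  have [k' ks|T' sT' hT'] := IH; first by apply: hs; rewrite in_cons ks orbT.
  exists (f k *: translation k + T').
    by apply: isotropy_spanD => //; apply: hs; exact: mem_head.
  by move=> xi g; rewrite big_cons op_linE hT'.
have [k|T' sT' hT'] := spanP (fset_set D).
  by rewrite in_fset_set // => /set_mem[].
suff -> : chi R [set x] \o T \o chi R [set x] = T' by [].
apply: op_ext => xi g /=; rewrite hT' chiE -fsbig_finite //.
have [gx|gx] := pselect (range_of g = x); last first.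
  rewrite indF // mul0r fsbig1 // => k [ik _].
  by rewrite translationE // indF // mul0r mulr0.
rewrite indT // mul1r rT /convolution.
rewrite -(@fsbig_widen _ _ _ _ ((fun k => (k, left_div k g)) @` D)).
- rewrite fsbig_image; last by move=> k k' _ _ [].
  apply: eq_fsbigr => k /set_mem [ik _] /=.
  by rewrite chiE translationE // !indT ?mul1r //=; exact: left_div_range.
- by move=> _ [k [[k1 k2] _] <-] /=; apply: left_divP; rewrite gx k1.
move=> [k h] /= [p nD]; rewrite chiE.
have [hx|hx] := pselect (range_of h = x); last by rewrite indF // mul0r mulr0.
have [p1 p2 p3 p4] := p.
have ik : isotropy k by split; rewrite ?p1 // -p2.
have [Kk|/fK ->] := pselect (K k); last by rewrite mul0r.
by exfalso; apply: nD; exists k; [split=> //; exact: hN|rewrite (left_div_eq p)].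
Qed.

Lemma compression_isotropy_algebra S : OX R X S ->
  isotropy_algebra (chi R [set x] \o S \o chi R [set x]).
Proof.
move=> [bS hS]; have bQ := chi_bounded R [set x]; split.
  by apply: bounded_comp => //; exact: bounded_comp.
move=> e e0; have [T [f [_ sf rT]] hT] := hS e e0.
exists (chi R [set x] \o T \o chi R [set x]); first exact: compression_span rT.
move=> xi /=; rewrite -(boundedB _ _ bQ); apply: le_trans (chi_norm _ _) _.
apply: le_trans (hT _) _; rewrite ler_wpM2l ?(ltW e0) //; exact: chi_norm.
Qed.

Lemma nbhs_isotropyC k : isotropy k -> forall g, g <> k -> nbhs g [set h | h <> k].
Proof.
move=> [k1 k2] g gk.
have cx := is_clopen_isolated x_isolated.
have [gx|gx] := pselect (range_of g = x); last first.
  by apply: filterS (range_of_nbhs cx.2 gx) => h /= hx e; apply: hx; rewrite e.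
have [sgx|sgx] := pselect (source_of g = x); last first.
  by apply: filterS (source_of_nbhs cx.2 sgx) => h /= hx e; apply: hx; rewrite e.
apply: filterS (degree_nbhs g) => h /= dh e; apply: gk.
by apply: groupoid_eq; rewrite ?k1 ?k2 // -dh e.
Qed.

(** As x is isolated in the cover, isotropy elements at x are isolated in the
    groupoid, and functions supported on finitely many of them are continuous. *)
Lemma isotropy_span_Cc T : isotropy_span T -> Cc_operators T.
Proof.
move=> hT; suff [f [cf ff rf]] : exists f : G -> R[i],
    [/\ continuous f, finite_set [set g | f g != 0] & represents f T].
  exists f; split=> //; exists [set g | f g != 0]; first exact: finite_compact.
  by move=> g /= /negP; rewrite negbK => /eqP.
elim: hT => [|a k T' ik _ [f [cf ff [bT' rT']]]].
  exists (fun=> 0); split.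
  - exact: cst_continuous.
  - rewrite (_ : [set g | _] = set0); first exact: finite_set0.
    by apply/seteqP; split=> g //=; rewrite eqxx.
  - split; first exact: bounded_op0.
    by move=> xi g; rewrite /convolution fsbig1 // => p _; rewrite mul0r.
pose f' g : R[i] := a * ind R (eq k) g.
have ff' : finite_set [set g | f' g != 0].
  apply: (@sub_finite_set _ _ [set k]) => // g /= h; apply: contrapT => gk.
  by move: h; rewrite /f' indF ?mulr0 ?eqxx // => /esym.
exists (fun g => f' g + f g); split.
- apply: continuous_near => g; have [->|gk] := pselect (g = k).
    exists (fun=> f' k + f k); first exact: cst_continuous.
    by apply: filterS (isotropy_isolated x_isolated ik.1 ik.2) => h /= ->.
  exists f => //; apply: filterS (nbhs_isotropyC ik gk) => h /= hk.
  by rewrite /f' indF ?mulr0 ?add0r // => /esym.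
- apply: (@sub_finite_set _ _ ([set g | f' g != 0] `|` [set g | f g != 0])).
    move=> g /= h; have [e|e] := eqVneq (f' g) 0; [right|by left].
    by rewrite e add0r in h.
  by rewrite finite_setU; split.
split; first by apply: bounded_lin => //; exact: translation_bounded.
move=> xi g; pose D := [set g | f' g != 0] `|` [set g | f g != 0].
pose P := [set p : G * G | is_product p.1 p.2 g /\ D p.1].
have finP : finite_set P.
  apply: (@sub_finite_set _ _ ((fun k => (k, left_div k g)) @` D)).
    by move=> [k' h] /= [p Dk]; exists k'; rewrite // (left_div_eq p).
  by apply: finite_image; rewrite finite_setU; split.
have widen (F : G -> R[i]) : (forall g, F g != 0 -> D g) ->
    convolution F xi g = \sum_(p \in P) (F p.1 * xi p.2).
  move=> FD; rewrite /convolution -(@fsbig_widen _ _ _ _ P) //; first by move=> p [].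
  move=> [k' h] /= [p nP]; have [->|/FD Dk] := eqVneq (F k') 0; first by rewrite mul0r.
  by exfalso; apply: nP.
rewrite op_linE rT' widen; last by move=> h; right.
rewrite widen; last first.
  move=> h /= ne; have [e|e] := eqVneq (f' h) 0; [right|by left].
  by rewrite e add0r in ne.
rewrite [RHS](eq_fsbigr (fun p => f' p.1 * xi p.2 + f p.1 * xi p.2)); last first.
  by move=> p _; rewrite mulrDl.
rewrite fsbig_split //= -(widen f'); last by move=> h; left.
congr (_ + _).
have [gx|gx] := pselect (range_of g = x).
  have [|p1 p2 p3 p4] := @left_divP k g; first by rewrite gx ik.1.
  rewrite (@convolution1 _ _ _ f' xi k (left_div k g)) //.
    by rewrite /f' (@indT _ _ (eq k)) // mulr1 translationE // indT // mul1r.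
  move=> k' h' q ne; rewrite /f'; have [kk'|kk'] := pselect (k = k').
    by exfalso; apply: ne; rewrite -kk' in q *; rewrite (left_div_eq q).
  by rewrite indF // mulr0 mul0r.
rewrite translationE // indF // mul0r mulr0 /convolution fsbig1 //.
move=> [k' h'] /= [_ q _ _].
rewrite /f'; have [kk'|kk'] := pselect (k = k'); last by rewrite indF // mulr0 mul0r.
by exfalso; apply: gx; rewrite q -kk' ik.1.
Qed.

Lemma isotropy_algebra_OX : isotropy_algebra `<=` OX R X.
Proof. by apply: norm_closureS => T; exact: isotropy_span_Cc. Qed.

End Corner.

(** * The gauge action and idempotents *)

Section Gauge.
Variables (R : realType) (A : finType) (X : shift_space A).
Local Notation G := (groupoid X).
Local Notation l2G := (l2 R G).
Implicit Types (g h k : G) (xi eta : l2G) (S T E F : l2G -> l2G) (t : R).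

Definition phase t : R[i] := cos t +i* sin t.

Lemma phaseD s t : phase (s + t) = phase s * phase t.
Proof. by rewrite /phase cosD sinD; congr (_ +i* _); rewrite addrC. Qed.

Lemma phase0 : phase 0 = 1.
Proof. by rewrite /phase cos0 sin0. Qed.

Lemma sqmod_phase t : sqmod (phase t) = 1.
Proof. exact: cos2Dsin2. Qed.

Lemma sqmod_phaseB1 t : sqmod (1 - phase t) = 2 - 2 * cos t.
Proof.
have := cos2Dsin2 t; rewrite /sqmod /phase /= => e.
have -> : (1 - cos t) ^+ 2 + (0 - sin t) ^+ 2 =
  1 - 2 * cos t + (cos t ^+ 2 + sin t ^+ 2) by ring.
by rewrite e; ring.
Qed.

(** Conjugation by these weights is the gauge action of the circle, in the
    parameter t of the angle. *)
Definition gauge_weight t g : R[i] := phase ((degree g)%:~R * t).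

Lemma gauge_contractive t : contractive_comp (gauge_weight t) id.
Proof. by split=> [s|? ? //]; rewrite sqmod_phase. Qed.

Definition gauge t : l2G -> l2G := weighted_comp (gauge_weight t) id.

Lemma gaugeE t xi g : gauge t xi g = gauge_weight t g * xi g.
Proof. by rewrite /gauge weighted_compE //; exact: gauge_contractive. Qed.

Lemma gauge_bounded t : bounded_operator (gauge t).
Proof. by apply: weighted_comp_bounded; exact: gauge_contractive. Qed.

Lemma gauge_norm t xi : l2norm (gauge t xi) <= l2norm xi.
Proof. by apply: weighted_comp_norm; exact: gauge_contractive. Qed.

Lemma gauge_weightN t g : gauge_weight (- t) g * gauge_weight t g = 1.
Proof. by rewrite /gauge_weight -phaseD mulrN addNr phase0. Qed.

Lemma gaugeK t : gauge (- t) \o gauge t = id.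
Proof. by apply: op_ext => xi g /=; rewrite !gaugeE mulrA gauge_weightN mul1r. Qed.

Definition gauge_conj t T : l2G -> l2G := gauge t \o T \o gauge (- t).

Lemma gauge_conj_bounded t T : bounded_operator T -> bounded_operator (gauge_conj t T).
Proof.
by move=> bT; do ![apply: bounded_comp => //]; exact: gauge_bounded.
Qed.

Lemma gauge_conj_comp t S T : gauge_conj t S \o gauge_conj t T = gauge_conj t (S \o T).
Proof.
apply/funext => xi; rewrite /gauge_conj /=.
by rewrite -[gauge (- t) (gauge t _)]/((gauge (- t) \o gauge t) _) gaugeK.
Qed.

Lemma gauge_conj_norm t S T (e : R) :
  (forall xi, l2norm (S xi - T xi) <= e * l2norm xi) ->
  0 <= e -> forall xi, l2norm (gauge_conj t S xi - gauge_conj t T xi) <= e * l2norm xi.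
Proof.
move=> h e0 xi; rewrite /gauge_conj /= -(boundedB _ _ (gauge_bounded t)).
apply: le_trans (gauge_norm _ _) _; apply: le_trans (h _) _.
by rewrite ler_wpM2l // gauge_norm.
Qed.

Lemma gauge_conj_lin t a S T :
  gauge_conj t (a *: S + T) = a *: gauge_conj t S + gauge_conj t T.
Proof.
apply/funext => xi; rewrite /gauge_conj /=.
by rewrite -[RHS]/(a *: gauge t (S (gauge (- t) xi)) + gauge t (T (gauge (- t) xi)))
  -(bounded_linear (gauge_bounded t)).
Qed.

Section IsotropyAlgebra.
Variable x : cover X.

Lemma gauge_conj_translation t k : isotropy x k ->
  gauge_conj t (translation x k) = gauge_weight t k *: translation x k.
Proof.
move=> ik; apply: op_ext => xi g.
rewrite -[RHS]/(gauge_weight t k * translation x k xi g) /gauge_conj /=.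
rewrite gaugeE !translationE // gaugeE.
have [gx|gx] := pselect (range_of g = x); last by rewrite indF ?mul0r ?mulr0.
have [|p1 p2 p3 p4] := @left_divP _ _ k g; first by rewrite gx ik.1.
rewrite indT // !mul1r mulrA; congr (_ * _).
rewrite /gauge_weight -phaseD p4 rmorphD /=; congr phase; ring.
Qed.

Lemma gauge_conj_span t T :
  isotropy_span x T -> isotropy_span x (gauge_conj t T).
Proof.
elim=> [|a k T' ik _ IH].
  rewrite (_ : gauge_conj t 0 = 0); first exact: isotropy_span0.
  by apply: op_ext => xi g; rewrite /gauge_conj /= [(0 : l2G -> l2G) _](_ : _ = 0) //
    (bounded0 (gauge_bounded t)).
by rewrite gauge_conj_lin gauge_conj_translation // scalerA; exact: isotropy_spanD.
Qed.

Lemma gauge_conj_algebra t T :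
  isotropy_algebra x T -> isotropy_algebra x (gauge_conj t T).
Proof.
move=> [bT hT]; split; first exact: gauge_conj_bounded.
move=> e e0; have [T' sT' hT'] := hT e e0.
exists (gauge_conj t T'); first exact: gauge_conj_span.
by apply: gauge_conj_norm => //; exact: ltW.
Qed.

Lemma phase_near (n : int) (e : R) : 0 < e ->
  \forall t \near (0 : R), sqmod (1 - phase (n%:~R * t)) <= e.
Proof.
move=> e0; have c : (fun t : R => cos (n%:~R * t)) @ (0 : R) --> cos (n%:~R * 0).
  apply: (@continuous_comp _ _ _ (fun t : R => n%:~R * t) cos);
    last exact: continuous_cos.
  exact: mulrl_continuous.
have e2 : 0 < e / 2 by rewrite divr_gt0.
have /cvgrPdist_le /(_ _ e2) := c; apply: filterS => t.
rewrite mulr0 cos0 sqmod_phaseB1 => h.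
have := le_trans (ler_norm _) h; lra.
Qed.

(** On a single translation the gauge action is a scalar of modulus one. *)
Lemma gauge_conj_continuous_span T (e : R) : isotropy_span x T -> 0 < e ->
  \forall t \near (0 : R), forall xi,
    l2norm (T xi - gauge_conj t T xi) <= e * l2norm xi.
Proof.
move=> sT; elim: sT e => [|a k T1 ik _ IH] e e0.
  apply: (@nearW _ (nbhs (0 : R))) => t xi.
  rewrite /gauge_conj /= [(0 : l2G -> l2G) _](_ : _ = 0) //.
  rewrite [(0 : l2G -> l2G) _](_ : _ = 0) //.
  rewrite (bounded0 (gauge_bounded t)) subrr.
  rewrite (_ : l2norm 0 = 0) ?mulr_ge0 ?l2norm_ge0 ?(ltW e0) //.
  by rewrite /l2norm /sqnorm esum1 ?sqrtr0 // => s _ /=; rewrite expr0n addr0.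
have bL := translation_bounded R ik.
have [M M0 hM] := bounded_ge0 bL.
pose C := Num.sqrt (sqmod a) * M + 1.
have C0 : 0 < C by rewrite ltr_wpDl // mulr_ge0 ?sqrtr_ge0 ?ltW.
have e4 : 0 < e / 4 by rewrite divr_gt0.
have d0 : 0 < (e / 4 / C) ^+ 2 by rewrite exprn_gt0 // divr_gt0.
apply: filterS2 (IH _ e4) (phase_near (degree k) d0) => t h1 h2 xi.
rewrite gauge_conj_lin gauge_conj_translation //.
have -> : (a *: translation x k + T1) xi -
    (a *: (gauge_weight t k *: translation x k) + gauge_conj t T1) xi =
    (a * (1 - gauge_weight t k)) *: translation x k xi + (T1 xi - gauge_conj t T1 xi).
  apply: l2_ext => g; rewrite l2_linE !l2_subE.
  rewrite -[(a *: translation x k + T1) xi g]/(a * translation x k xi g + T1 xi g).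
  rewrite -[X in _ - X]/(a * (gauge_weight t k * translation x k xi g) +
    gauge_conj t T1 xi g).
  ring.
apply: le_trans (l2norm_lin _ _ _) _; rewrite sqmodM sqrtrM ?sqmod_ge0 //.
have h3 : Num.sqrt (sqmod (1 - gauge_weight t k)) <= e / 4 / C.
  have q0 : 0 <= e / 4 / C by rewrite ltW // divr_gt0.
  by rewrite -(ger0_norm q0) -sqrtr_sqr ler_wsqrtr.
have h4 : Num.sqrt (sqmod a) * Num.sqrt (sqmod (1 - gauge_weight t k)) *
    l2norm (translation x k xi) <= e / 4 * l2norm xi.
  apply: (@le_trans _ _ (Num.sqrt (sqmod a) * (e / 4 / C) * (M * l2norm xi))).
    by apply: ler_pM; rewrite ?mulr_ge0 ?sqrtr_ge0 ?l2norm_ge0 // ler_wpM2l ?sqrtr_ge0.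
  have -> : Num.sqrt (sqmod a) * (e / 4 / C) * (M * l2norm xi) =
    (Num.sqrt (sqmod a) * M / C) * (e / 4 * l2norm xi) by ring.
  apply: ler_piMl; first by rewrite mulr_ge0 ?l2norm_ge0 // ltW.
  by rewrite ler_pdivrMr // mul1r /C lerDl.
have := h1 xi; lra.
Qed.

Lemma gauge_conj_continuous T (e : R) : isotropy_algebra x T -> 0 < e ->
  \forall t \near (0 : R), forall xi,
    l2norm (T xi - gauge_conj t T xi) <= e * l2norm xi.
Proof.
move=> [bT hT] e0.
(* Three estimates by e/16 are combined by two applications of [l2norm_add], each
   of which costs a factor 2. *)
have e16 : 0 < e / 16 by rewrite divr_gt0.
have [T' sT' hT'] := hT _ e16.
have := gauge_conj_continuous_span sT' e16.
apply: filterS => t h xi.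
have -> : T xi - gauge_conj t T xi =
    (T xi - T' xi) +
    ((T' xi - gauge_conj t T' xi) - (gauge_conj t T xi - gauge_conj t T' xi)).
  by rewrite opprB subrKA addrA subrK.
apply: le_trans (l2norm_add _ _) _.
have h1 := l2norm_add (T' xi - gauge_conj t T' xi)
  (- (gauge_conj t T xi - gauge_conj t T' xi)).
rewrite l2normN in h1.
have h2 := gauge_conj_norm t hT' (ltW e16) xi.
have en : 0 <= e * l2norm xi by rewrite mulr_ge0 ?l2norm_ge0 // ltW.
move: (h xi) (hT' xi) en h1 h2; move: (l2norm xi) (l2norm (T xi - T' xi)) => n p.
move: (l2norm (T' xi - gauge_conj t T' xi)) (l2norm (gauge_conj t T xi - _)) => q r.
move: (l2norm _) => s; lra.
Qed.

End IsotropyAlgebra.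

(** For commuting idempotents E and F one has (E - F)^3 = E - F. *)
Lemma idempotents_close_eq E F : bounded_operator E -> bounded_operator F ->
  E \o E = E -> F \o F = F -> E \o F = F \o E ->
  (forall xi, l2norm (E xi - F xi) <= 2^-1 * l2norm xi) -> E = F.
Proof.
move=> bE bF EE FF EF h; apply/funext => xi; apply/eqP; rewrite -subr_eq0; apply/eqP.
have EEx z : E (E z) = E z by rewrite -[LHS]/((E \o E) z) EE.
have FFx z : F (F z) = F z by rewrite -[LHS]/((F \o F) z) FF.
have EFx z : F (E z) = E (F z) by rewrite -[LHS]/((F \o E) z) -EF.
pose D z := E z - F z.
have D3 : D xi = D (D (D xi)).
  rewrite /D !(boundedB _ _ bE, boundedB _ _ bF) !(EFx, EEx, FFx).
  apply: l2_ext => g; rewrite !l2_subE; ring.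
apply: l2norm_eq0; apply/eqP; rewrite eq_le l2norm_ge0 andbT -/(D xi).
have := h (D (D xi)); have := h (D xi); rewrite -/(D _) -/(D (D _)) -D3.
have := l2norm_ge0 (D (D xi)); lra.
Qed.

(** The reason is that the spectrum of the group algebra of the integers is a
    circle, hence connected.  At an isolated point x, the compression F of E to x
    lies in the commutative algebra generated by the isotropy at x.  Its gauge
    translates are idempotents of the same algebra and tend to F in norm as the
    parameter tends to 0, hence equal F for small parameters; so F has no
    coefficient of nonzero degree. *)
Lemma idempotent_commutant_DX E : OX R X E -> E \o E = E -> commutes_CX E -> DX R X E.
Proof.
move=> OE EE cE; apply: diagonal_DX => // g Eg.
have [//|[rs xiso]] := commutant_symbol OE cE Eg.
split=> //; apply: contrapT => dg; set x := range_of g in xiso.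
have bE := OX_bounded OE; pose Q := chi R [set x].
have QE : E \o Q = Q \o E by apply: commutant_chi.
have QQ : Q \o Q = Q by rewrite /Q chiI setIid.
pose F := Q \o E \o Q.
have FF : F \o F = F.
  have QEx z : E (Q z) = Q (E z) by rewrite -[LHS]/((E \o Q) z) QE.
  have EEx z : E (E z) = E z by rewrite -[LHS]/((E \o E) z) EE.
  have QQx z : Q (Q z) = Q z by rewrite -[LHS]/((Q \o Q) z) QQ.
  by apply/funext => xi; rewrite /F /= !(QEx, EEx, QQx).
have AF : isotropy_algebra x F by exact: compression_isotropy_algebra.
have bF : bounded_operator F by case: AF.
have h2 : 0 < 2^-1 :> R by rewrite invr_gt0.
have /nbhs_ballP [d /= d0 hd] := gauge_conj_continuous AF h2.
have n0 : 0 < `|(degree g)%:~R| :> R by rewrite normr_gt0 intr_eq0; exact/eqP.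
(* With this choice |deg g| t lies in (0, 1], where the cosine differs from 1. *)
pose t : R := Num.min (d / 2) `|(degree g)%:~R|^-1.
have t0 : 0 < t by rewrite /t lt_min divr_gt0 ?invr_gt0.
have td : ball (0 : R) d t.
  rewrite /ball /= sub0r normrN gtr0_norm // /t gt_min.
  by apply/orP; left; rewrite ltr_pdivrMr // ltr_pMr // ltr1n.
have eF : F = gauge_conj t F.
  apply: idempotents_close_eq (hd t td) => //.
  - exact: gauge_conj_bounded.
  - by rewrite gauge_conj_comp FF.
  - exact: (isotropy_algebra_comm AF (gauge_conj_algebra t AF)).
pose u := unit_at (source_of g).
have Fu : F (delta R u) g = symbol E g.
  have Qu : Q (delta R u) = delta R u by apply: restrict_delta; exact: esym rs.
  apply: (etrans (congr1 (fun z => Q (E z) g) Qu)); apply: (etrans (chiE _ _ _)).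
  by rewrite indT // mul1r.
have gu : gauge (- t) (delta R u) = delta R u.
  apply: l2_ext => h; rewrite gaugeE.
  have [<-|uh] := pselect (u = h); last by rewrite delta0 ?mulr0.
  by rewrite /gauge_weight mul0r phase0 mul1r.
have e1 : F (delta R u) g = gauge t (F (gauge (- t) (delta R u))) g.
  exact: (congr1 (fun T : l2G -> l2G => T (delta R u) g) eF).
move: e1; rewrite gu gaugeE Fu => /eqP.
rewrite eq_sym -subr_eq0 -{2}[symbol E g]mul1r -mulrBl mulf_eq0.
rewrite (negbTE Eg) orbF subr_eq0.
rewrite /gauge_weight => /eqP /(congr1 (@complex.Re R)) /= c1.
have : cos (`|(degree g)%:~R| * t) = 1.
  by rewrite -{1}(gtr0_norm t0) -normrM cos_norm.
have pos : 0 < `|(degree g)%:~R| * t by rewrite mulr_gt0.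
have le1 : `|(degree g)%:~R| * t <= 1.
  by rewrite mulrC -ler_pdivlMr // div1r /t ge_min lexx orbT.
have pi1 : 1 <= pi :> R by have := @pi_ge2 R; lra.
have : cos (`|(degree g)%:~R| * t) < cos 0.
  by rewrite ltr_cos // in_itv /= ?lexx ?pi_ge0 // (ltW pos) (le_trans le1 pi1).
by rewrite cos0 => /lt_eqF /eqP.
Qed.

End Gauge.

(** * Characterising the diagonal by the isolated points *)

Section Diagonal.
Variables (R : realType) (A : finType) (X : shift_space A).
Local Notation l2G := (l2 R (groupoid X)).
Implicit Types (x y : cover X) (U V : set (cover X)) (S T : l2G -> l2G).

Lemma chi_set0 : chi R (set0 : set (cover X)) = 0.
Proof. by apply: op_ext => xi g; rewrite chiE indF // mul0r. Qed.

Lemma is_clopen_set0 : is_clopen (set0 : set (cover X)).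
Proof. by split; [exact: open0|rewrite setC0; exact: openT]. Qed.

Lemma chi_unit U x : U x -> chi R U (delta R (unit_at x)) (unit_at x) = 1.
Proof. by move=> Ux; rewrite chiE indT // delta1 mul1r. Qed.

Lemma chi_neq0 U x : U x -> chi R U <> 0.
Proof.
move=> Ux e; have := chi_unit Ux; rewrite e => /eqP.
by rewrite [X in X == _](_ : _ = 0) // eq_sym oner_eq0.
Qed.

Lemma chi_inj U V : chi R U = chi R V -> U = V.
Proof.
move=> e; apply/seteqP; split=> x Wx; apply: contrapT => nWx.
  have := chi_unit Wx; rewrite e chiE indF // mul0r => /eqP.
  by rewrite eq_sym oner_eq0.
have := chi_unit Wx; rewrite -e chiE indF // mul0r => /eqP.
by rewrite eq_sym oner_eq0.
Qed.

(** A continuous function with values 0 and 1 is the indicator of a clopen set. *)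
Lemma idempotent_DX T : DX R X T -> T \o T = T ->
  exists2 U, is_clopen U & T = chi R U.
Proof.
move=> /DXP [_ [f cf hf]] TT.
have f01 x : f x = 0 \/ f x = 1.
  have := congr1 (fun S : l2G -> l2G => S (delta R (unit_at x)) (unit_at x)) TT.
  rewrite /= !hf delta1 !mulr1 /= => /eqP.
  rewrite -{3}[f x]mulr1 -subr_eq0 -mulrBr mulf_eq0 subr_eq0.
  by move=> /orP[/eqP|/eqP]; [left|right].
have near x : nbhs x [set y | f y = f x].
  have /(@cvgrPdist_lt _ _ _ _ (nbhs_filter x)) /(_ _ ltr01) h := cf x.
  apply: (@filterS _ (nbhs x) _ _ _ _ h) => y /=.
  have d01 : `|0 - 1 : R[i]| < 1 -> False by rewrite sub0r normrN1 ltxx.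
  by case: (f01 x) (f01 y) => -> [] -> //; rewrite ?(distrC 1 0) => /d01.
exists [set x | f x = 1].
  split; rewrite openE => x /= fx; apply: filterS (near x) => y /= ->; exact: fx.
apply: op_ext => xi g; rewrite hf chiE; congr (_ * _).
have [e|e] := f01 (range_of g); last by rewrite indT.
by rewrite e indF //= e => /eqP; rewrite eq_sym oner_eq0.
Qed.

Lemma DX_comp_point T x : DX R X T ->
  exists c : R[i], T \o chi R [set x] = c *: chi R [set x].
Proof.
move=> /DXP [_ [f _ hf]]; exists (f x); apply: op_ext => xi g /=.
rewrite -[RHS]/(f x * chi R [set x] xi g) hf chiE.
have [<-//|gx] := pselect (range_of g = x).
by rewrite indF // mul0r !mulr0.
Qed.

(** By [commutant_symbol], an element of the commutant of C(X) can fail to be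
    diagonal only over isolated points. *)
Lemma commutant_DX S : OX R X S -> commutes_CX S ->
  (forall x, nbhs x [set x] ->
     exists c : R[i], S \o chi R [set x] = c *: chi R [set x]) ->
  DX R X S.
Proof.
move=> OS cS hS; apply: diagonal_DX => // g Sg.
have [//|[rs xiso]] := commutant_symbol OS cS Sg.
have [c ec] := hS _ xiso; apply: contrapT => ng; move/eqP: Sg; apply.
have Qu : chi R [set range_of g] (delta R (unit_at (source_of g))) =
    delta R (unit_at (source_of g)).
  by apply: restrict_delta; exact: esym rs.
have e1 : S (delta R (unit_at (source_of g))) g =
    c * chi R [set range_of g] (delta R (unit_at (source_of g))) g.
  rewrite -{1}Qu.
  exact: (congr1
    (fun T : l2G -> l2G => T (delta R (unit_at (source_of g))) g) ec).
rewrite /symbol e1 Qu delta0 ?mulr0 // => e; apply: ng; rewrite -e; exact: is_unit_at.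
Qed.

(** The corner at x is the norm closure of the group algebra of the isotropy, which
    is closed under products. *)
Lemma corner_comp_OX S x : nbhs x [set x] -> OX R X S ->
  chi R [set x] \o S = S -> S \o chi R [set x] = S -> OX R X (S \o S).
Proof.
move=> xiso OS QS SQ.
have AS : isotropy_algebra x S by rewrite -SQ -QS; exact: compression_isotropy_algebra.
exact: (isotropy_algebra_OX xiso (isotropy_algebra_comp AS AS)).
Qed.

End Diagonal.

(** * Isomorphisms preserving C(X) *)

Section Isomorphism.
Variables (R : realType) (A B : finType) (X : shift_space A) (Y : shift_space B).
Local Notation l2X := (l2 R (groupoid X)).
Local Notation l2Y := (l2 R (groupoid Y)).
Variable Phi : (l2X -> l2X) -> (l2Y -> l2Y).
Hypothesis isoPhi : star_isomorphism (OX R X) (OX R Y) Phi.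
Hypothesis PhiC : Phi @` CX R X = CX R Y.
Implicit Types (S T : l2X -> l2X).

Let PhiM S T : OX R X S -> OX R X T -> Phi (S \o T) = Phi S \o Phi T.
Proof. exact: (star_iso_mul isoPhi). Qed.

Let Phi_OX S : OX R X S -> OX R Y (Phi S).
Proof. by have [h _ _] := star_iso_bij isoPhi; exact: h. Qed.

Let Phi_inj S T : OX R X S -> OX R X T -> Phi S = Phi T -> S = T.
Proof.
by have [_ h _] := star_iso_bij isoPhi => OS OT; apply: h; exact: mem_set.
Qed.

Let Phi_surj (T' : l2Y -> l2Y) : OX R Y T' -> exists2 T, OX R X T & Phi T = T'.
Proof. by have [_ _ h] := star_iso_bij isoPhi; exact: h. Qed.

Let OX0 : OX R X 0.
Proof. by rewrite -chi_set0; apply: chi_OX; exact: is_clopen_set0. Qed.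

Let Phi0 : Phi 0 = 0.
Proof.
have := star_iso_linear isoPhi (-1) OX0 OX0.
by rewrite !scaleN1r !addNr.
Qed.

Let PhiZ (c : R[i]) T : OX R X T -> Phi (c *: T) = c *: Phi T.
Proof. by move=> OT; have := star_iso_linear isoPhi c OT OX0; rewrite Phi0 !addr0. Qed.

(** C(Y) is the image of C(X), and D_X is commutative. *)
Lemma iso_DX_commutes T : DX R X T -> commutes_CX (Phi T).
Proof.
move=> DT n b; have : CX R Y (chi R (cylinder_above n b)) by exact: chi_symbol_CX.
rewrite -PhiC => -[T' CT' <-]; have DT' := CX_sub_DX CT'.
have OT := DX_sub_OX DT; have OT' := DX_sub_OX DT'.
by rewrite -(PhiM OT OT') -(PhiM OT' OT) (DX_comm DT DT').
Qed.

Lemma preimage_DX_commutes S : OX R X S -> DX R Y (Phi S) -> commutes_CX S.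
Proof.
move=> OS DS n a; have cU := cylinder_above_clopen X n a.
have OU := chi_OX R cU.
apply: Phi_inj; [exact: OX_comp_chi|exact: OX_chi_comp|].
rewrite (PhiM OS OU) (PhiM OU OS).
apply: DX_comm => //; apply: CX_sub_DX; rewrite -PhiC.
by exists (chi R (cylinder_above n a)) => //; exact: chi_symbol_CX.
Qed.

(** Idempotents of the commutants are indicators of clopen sets, and Phi preserves
    the property of being such an idempotent. *)
Lemma iso_chi (U : set (cover X)) : is_clopen U ->
  exists2 V : set (cover Y), is_clopen V & Phi (chi R U) = chi R V.
Proof.
move=> cU; have OU := chi_OX R cU.
have idem : Phi (chi R U) \o Phi (chi R U) = Phi (chi R U).
  by rewrite -(PhiM OU OU) chiI setIid.
apply: idempotent_DX => //; apply: idempotent_commutant_DX => //; first exact: Phi_OX.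
by apply: iso_DX_commutes; exact: chi_DX.
Qed.

(** The square of S belongs to the algebra because S lies in the corner at x, so
    that S is an idempotent of the commutant; it is then an indicator, supported on
    a single point. *)
Lemma corner_idempotent S (x : cover X) (V : set (cover Y)) :
  nbhs x [set x] -> OX R X S ->
  chi R [set x] \o S = S -> S \o chi R [set x] = S -> is_clopen V -> Phi S = chi R V ->
  S = 0 \/ S = chi R [set x].
Proof.
move=> xiso OS QS SQ cV PS.
have SS : S \o S = S.
  apply: (Phi_inj (corner_comp_OX xiso OS QS SQ) OS).
  by rewrite (PhiM OS OS) PS chiI setIid.
have DPS : DX R Y (Phi S) by rewrite PS; exact: chi_DX.
have DS := idempotent_commutant_DX OS SS (preimage_DX_commutes OS DPS).
have [U _ eU] := idempotent_DX DS SS.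
move: QS; rewrite eU chiI => <-.
have [Ux|Ux] := pselect (U x).
  right; congr (chi R _); apply/seteqP; split=> z; first by case.
  by move=> ->.
left; rewrite -chi_set0; congr (chi R _); apply/seteqP; split=> // z [/= -> Uz].
by case: (Ux Uz).
Qed.

(** The preimage E of the projection of an isolated point y is nonzero, so its
    symbol is nonzero at some g.  Let x be the range of g.  Every clopen U
    containing x satisfies 1_U E = E, since the image of 1_U is the indicator of
    a clopen set, which contains y or not; hence E lies in the corner at x. *)
Lemma isolated_preimage (y : cover Y) : nbhs y [set y] ->
  exists2 x : cover X, nbhs x [set x] & Phi (chi R [set x]) = chi R [set y].
Proof.
move=> yiso; have cy := is_clopen_isolated yiso.
have [E OE PE] := Phi_surj (chi_OX R cy).
have cE : commutes_CX E.
  by apply: preimage_DX_commutes => //; rewrite PE; exact: chi_DX.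
have [g Eg] : exists g, symbol E g != 0.
  apply: contrapT => h; have E0 : E = 0.
    apply: OX_eq0 => // g; apply/eqP; apply: contraT => Eg.
    by exfalso; apply: h; exists g.
  by move: PE; rewrite E0 Phi0 => /esym; exact: (@chi_neq0 _ _ _ [set y] y).
set x := range_of g.
have UE U : is_clopen U -> U x -> chi R U \o E = E.
  move=> cU Ux; have OUE := OX_chi_comp cU OE.
  have [V _ eV] := iso_chi cU.
  have PUE : Phi (chi R U \o E) = chi R (V `&` [set y]).
    by rewrite (PhiM (chi_OX R cU) OE) eV PE chiI.
  have [Vy|Vy] := pselect (V y).
    apply: (Phi_inj OUE OE); rewrite PUE PE.
    by congr (chi R _); apply/seteqP; split=> z; [case|move=> /= ->].
  exfalso; have UE0 : chi R U \o E = 0.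
    apply: (Phi_inj OUE OX0); rewrite PUE Phi0 -chi_set0.
    by congr (chi R _); apply/seteqP; split=> // z [Vz /= zy]; apply: Vy; rewrite -zy.
  have := congr1 (fun T : l2X -> l2X => T (delta R (unit_at (source_of g))) g) UE0.
  rewrite [LHS]chiE indT // mul1r => e; move/eqP: Eg; apply; exact: e.
have Ex h : symbol E h != 0 -> range_of h = x.
  move=> Eh; apply: contrapT => hx.
  have [U [oU oU' Ux Uh]] := cover_separated (nesym hx).
  have := congr1 (fun T : l2X -> l2X => T (delta R (unit_at (source_of h))) h)
    (UE U (conj oU oU') Ux).
  by rewrite [LHS]chiE indF // mul0r => e; move/eqP: Eh; apply; rewrite /symbol -e.
have xiso : nbhs x [set x].
  have /range_of_open : nbhs g [set h | symbol E h != 0].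
    exact: (@cvgr_neq0 _ _ _ _ (nbhs_filter g) _ _ (symbol_continuous OE (x := g)) Eg).
  by apply: filterS => _ [h /= Eh <-]; exact: Ex.
exists x => //; have cx := is_clopen_isolated xiso.
have QE := UE _ cx erefl.
have EQ : E \o chi R [set x] = E by rewrite commutant_chi.
have [E0|<- //] := corner_idempotent xiso OE QE EQ cy PE.
by move/eqP: Eg; case; rewrite E0.
Qed.

(** Were there two points in the set V with indicator Phi 1_x, separating them
    would split the minimal idempotent 1_x. *)
Lemma isolated_image (x : cover X) : nbhs x [set x] ->
  exists y : cover Y, Phi (chi R [set x]) = chi R [set y].
Proof.
move=> xiso; have cx := is_clopen_isolated xiso; have OQ := chi_OX R cx.
have [V cV PV] := iso_chi cx.
have [y Vy] : exists y, V y.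
  apply: contrapT => h; have V0 : V = set0.
    by apply/seteqP; split=> // y Vy; apply: h; exists y.
  apply: (@chi_neq0 R _ _ [set x] x erefl); apply: (Phi_inj OQ OX0).
  by rewrite PV V0 chi_set0 Phi0.
exists y; rewrite PV; congr (chi R _); apply/seteqP; split=> [z Vz|_ -> //].
apply: contrapT => /nesym /cover_separated [W [oW oW' Wy Wz]].
have cVW := is_clopenI cV (conj oW oW').
have [S OS PS] := Phi_surj (chi_OX R cVW).
have VVW : V `&` (V `&` W) = V `&` W by rewrite setIA setIid.
have QS : chi R [set x] \o S = S.
  apply: (Phi_inj (OX_chi_comp cx OS) OS).
  by rewrite (PhiM OQ OS) PV PS chiI VVW.
have SQ : S \o chi R [set x] = S.
  apply: (Phi_inj (OX_comp_chi cx OS) OS).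
  by rewrite (PhiM OS OQ) PV PS chiI [_ `&` V]setIC VVW.
case: (corner_idempotent xiso OS QS SQ cVW PS) => eS.
  by apply: (@chi_neq0 R _ _ (V `&` W) y); rewrite -?PS ?eS.
have : V z by [].
have /chi_inj -> : chi R V = chi R (V `&` W) by rewrite -PV -PS eS.
by move=> [].
Qed.

(** For an isolated point y with 1_y = Phi 1_x, the operator (Phi T) 1_y is the
    image of T 1_x, a multiple of 1_x. *)
Lemma iso_DX_sub T : DX R X T -> DX R Y (Phi T).
Proof.
move=> DT; have OT := DX_sub_OX DT.
apply: commutant_DX; [exact: Phi_OX|exact: iso_DX_commutes|move=> y yiso].
have [x xiso ex] := isolated_preimage yiso; have cx := is_clopen_isolated xiso.
have [c ec] := DX_comp_point x DT; exists c.
have OQ := chi_OX R cx.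
by rewrite -ex -(PhiM OT OQ) ec (PhiZ _ OQ).
Qed.

Lemma iso_DX_sup S : OX R X S -> DX R Y (Phi S) -> DX R X S.
Proof.
move=> OS DS; apply: commutant_DX => //; first exact: preimage_DX_commutes.
move=> x xiso; have cx := is_clopen_isolated xiso.
have [y ey] := isolated_image xiso.
have [c ec] := DX_comp_point y DS; exists c.
apply: Phi_inj; [exact: OX_comp_chi|exact: scale_chi_OX|].
have OQ := chi_OX R cx.
by rewrite (PhiM OS OQ) (PhiZ _ OQ) ey ec.
Qed.

End Isomorphism.

Theorem theorem3p3 (R : realType) (A B : finType)
    (X : shift_space A) (Y : shift_space B)
    (Phi : (l2 R (groupoid X) -> l2 R (groupoid X)) ->
           (l2 R (groupoid Y) -> l2 R (groupoid Y)))
    (isoPhi : star_isomorphism (OX R X) (OX R Y) Phi)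
    (PhiC : Phi @` CX R X = CX R Y) :
  Phi @` DX R X = DX R Y.
Proof.
apply/seteqP; split=> [_ [T DT <-]|T' DT']; first exact: iso_DX_sub.
have [_ _ surj] := star_iso_bij isoPhi.
have [S OS PS] := surj _ (DX_sub_OX DT').
exists S => //; apply: (iso_DX_sup isoPhi PhiC OS).
by rewrite PS.
Qed.
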